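(* Fix $\xi<\omega_1$ and let $P=(\mathfrak{P},\mathcal{P})$ be a $\xi$-homogeneous probability block. Let $X$ be a Banach space, $(R,r)$ a subsequential space on $X$, and $s$ a bimonotone norm on $c_{00}(X)$ with natural domain $S$. The following are equivalent. (1) For every $\varsigma\in R$, there exists $M\in[\mathbb{N}]$ such that for every $N\in[M]$, $\mathbb{E}^P_N\varsigma\in S$. (2) For every $\varsigma\in R$, there exist $M\in[\mathbb{N}]$ and a constant $C$ such that for every $N\in[M]$, $\mathbb{E}^P_N\varsigma\in CB_S$. (3) There exists a constant $C$ such that for every $\varsigma\in B_R$, there exists $M\in[\mathbb{N}]$ such that for every $N\in[M]$, $\mathbb{E}^P_N\varsigma\in CB_S$. (4) For every $\varsigma\in R$ and $L\in[\mathbb{N}]$, there exists $M\in[L]$ such that for all $N\in[M]$, $\mathbb{E}^P_N\varsigma\in S$. (5) For every $\varsigma\in R$ and $L\in[\mathbb{N}]$, there exist $M\in[L]$ and a constant $C$ such that for all $N\in[M]$, $\mathbb{E}^P_N\varsigma\in CB_S$. (6) There exists a constant $C$ such that for every $\varsigma\in B_R$ and every $L\in[\mathbb{N}]$, there exists $M\in[L]$ such that for all $N\in[M]$, $\mathbb{E}^P_N\varsigma\in CB_S$.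
   Context: Sets. $\mathbb{N}=\{1,2,\ldots\}$. For infinite $M\subset\mathbb{N}$, $[M]$ is the set of infinite subsets of $M$ and $[M]^{<\omega}$ the set of finite subsets. Subsets of $\mathbb{N}$ are identified with increasing sequences. $E\preceq F$ ($E\prec F$) means $E$ is an (a proper) initial segment of $F$; $E<F$ means $E=\varnothing$ or $F=\varnothing$ or $\max E<\min F$. Families. For $\mathcal{F}\subset[\mathbb{N}]^{<\omega}$, $MAX(\mathcal{F})$ is the set of $\preceq$-maximal members. $\mathcal{F}$ is spreading if $(m_i)_{i=1}^t\in\mathcal{F}$, $l_1<\cdots<l_t$, $m_i\leqslant l_i$ imply $(l_i)_{i=1}^t\in\mathcal{F}$; hereditary if closed under subsets; compact if compact in the product topology of $2^{\mathbb{N}}$; regular if all three. A regular $\mathcal{F}$ is nice if it contains all singletons and each $F\in\mathcal{F}$ is either in $MAX(\mathcal{F})$ or satisfies $F\cup\{n\}\in\mathcal{F}$ for all $n>F$. Derivatives of a hereditary $\mathcal{F}$: $\mathcal{F}^0=\mathcal{F}$, $\mathcal{F}^{\eta+1}=\mathcal{F}^\eta\setminus MAX(\mathcal{F}^\eta)$, intersections at limits; $\mathrm{rank}(\mathcal{F})$ is the least $\eta$ with $\mathcal{F}^\eta=\varnothing$. $M|\mathcal{F}$ is the maximal initial segment of $M$ belonging to $\mathcal{F}$. Probability blocks. For a probability measure $\mathbb{P}$ on $\mathbb{N}$ write $\mathbb{P}(i)=\mathbb{P}(\{i\})$ and $\mathrm{supp}(\mathbb{P})=\{i:\mathbb{P}(i)\neq0\}$.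 A probability block is a pair $(\mathfrak{P},\mathcal{P})$ with $\mathcal{P}$ nice and $\mathfrak{P}=\{\mathbb{P}_{M,n}:M\in[\mathbb{N}],n\in\mathbb{N}\}$ probability measures on $\mathbb{N}$ such that (i) $\mathrm{supp}(\mathbb{P}_{M,1})=M|\mathcal{P}$ for all $M$; (ii) if $M,N\in[\mathbb{N}]$ and $r\in\mathbb{N}$ satisfy $\mathrm{supp}(\mathbb{P}_{M,r})\prec N$, then $\mathbb{P}_{N,1}=\mathbb{P}_{M,r}$. It is understood that $(\mathrm{supp}(\mathbb{P}_{M,n}))_{n=1}^\infty$ is the unique partition of $M$ into successive members of $MAX(\mathcal{P})$. It is $\xi$-sufficient if for every regular $\mathcal{F}$ with $\mathrm{rank}(\mathcal{F})\leqslant\omega^\xi$, every $L\in[\mathbb{N}]$ and $\varepsilon>0$ there is $M\in[L]$ with $\sup\{\mathbb{P}_{N,1}(E):N\in[M],E\in\mathcal{F}\}\leqslant\varepsilon$; it is $\xi$-homogeneous if it is $\xi$-sufficient and $\mathrm{rank}(\mathcal{P})=\omega^\xi+1$. For $\varsigma=(x_n)_{n=1}^\infty\subset X$, $\mathbb{E}^P_M\varsigma$ is the sequence whose $n$-th term is $\sum_{i}\mathbb{P}_{M,n}(i)x_i$. Spaces. $\ell_\infty(X)$: bounded sequences in $X$, sup norm; $x\otimes e_n$: the sequence with $n$-th term $x$ and other terms $0$; $c_{00}(X)$: span of all $x\otimes e_n$; $\sum_n x_n\otimes e_n=(x_1,x_2,\ldots)$. A subsequential space on $X$ is a Banach space $(R,r)$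 with $c_{00}(X)\subset R\subset\ell_\infty(X)$ such that, with $B_R=\{r\leqslant1\}$, $B_R\subset B_{\ell_\infty(X)}$ and every subsequence of a member of $B_R$ is in $B_R$. A norm $s$ on $c_{00}(X)$ is bimonotone if $s(x\otimes e_n)=\|x\|$ always and $s((x_n))=\sup_{l\leqslant m}s(\sum_{n=l}^m x_n\otimes e_n)=\lim_m s(\sum_{n=1}^m x_n\otimes e_n)$ on $c_{00}(X)$. Its natural domain $S$ is the set of $(x_n)\in\ell_\infty(X)$ with $s((x_n)):=\sup_m s(\sum_{n=1}^m x_n\otimes e_n)<\infty$; $CB_S=\{\varsigma\in S:s(\varsigma)\leqslant C\}$. *)

(* Defs.v *)
From HB Require Import structures.
From mathcomp Require Import all_boot all_order all_algebra.
From mathcomp Require Import all_classical all_reals all_analysis.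

Set Implicit Arguments.
Unset Strict Implicit.
Unset Printing Implicit Defensive.

Import Order.TTheory GRing.Theory Num.Theory.
Import numFieldNormedType.Exports.

Local Open Scope classical_set_scope.
Local Open Scope ring_scope.

(* The index set is nat = {0, 1, 2, ...} instead of {1, 2, ...}.  Only the     *)
(* order of the index set is ever used, so this is a relabelling n |-> n - 1; *)
(* in particular the measure written P_{M,1} on paper is P M 0 here.           *)

(* ------------------------------ Ordinals ---------------------------------- *)

(* Notations for the countable ordinals.  Osup f denotes the supremum of the  *)
(* ordinals f 0, f 1, ... (no monotonicity is required, and the supremum may  *)
(* be attained), so every ordinal below omega_1, and no other, is denoted.    *)
(* An ordinal may have several notations: equality of ordinals is ord_le in   *)
(* both directions, and every function below respects it.                     *)
Inductive ord : Type :=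
| Ozero : ord
| Osucc : ord -> ord
| Osup : (nat -> ord) -> ord.

Inductive ord_le : ord -> ord -> Prop :=
| ord_le_zero b : ord_le Ozero b
| ord_le_succ a b : ord_le a b -> ord_le (Osucc a) (Osucc b)
| ord_le_sup_lub f b : (forall n, ord_le (f n) b) -> ord_le (Osup f) b
| ord_le_sup_ub a f n : ord_le a (f n) -> ord_le a (Osup f).

Fixpoint ord_add (a b : ord) : ord :=
  match b with
  | Ozero => a
  | Osucc b' => Osucc (ord_add a b')
  | Osup f => Osup (fun n => ord_add a (f n))
  end.

(* The product a * omega, i.e. the supremum of a * 0, a * 1, a * 2, ... *)
Definition ord_mul_omega (a : ord) : ord :=
  Osup (fun n => iter n (fun b => ord_add b a) Ozero).

Fixpoint omega_pow (a : ord) : ord :=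
  match a with
  | Ozero => Osucc Ozero
  | Osucc b => ord_mul_omega (omega_pow b)
  | Osup f => Osup (fun n => omega_pow (f n))
  end.

(* --------------------- Sets and families of integers ---------------------- *)

(* [M], for a set M of integers *)
Definition infsub (M : set nat) : set (set nat) :=
  [set N | infinite_set N /\ N `<=` M].

Definition initseg (E F : set nat) : Prop :=
  E `<=` F /\ forall x y, F x -> E y -> (x <= y)%N -> E x.

Definition proper_initseg (E F : set nat) : Prop := initseg E F /\ E <> F.

(* E = set0, or F = set0, or max E < min F *)
Definition set_before (E F : set nat) : Prop :=
  forall x y, E x -> F y -> (x < y)%N.

Definition MAX (F : set (set nat)) : set (set nat) :=
  [set E | F E /\ forall G, F G -> initseg E G -> G = E].

Definition spreading (F : set (set nat)) : Prop :=
  forall m l : seq nat, sorted ltn m -> sorted ltn l -> all2 leq m l ->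
    F [set` m] -> F [set` l].

Definition hereditary (F : set (set nat)) : Prop :=
  forall E G : set nat, F E -> G `<=` E -> F G.

Definition charfun (E : set nat) : cantor_space := fun n => `[< E n >].

Definition compact_family (F : set (set nat)) : Prop :=
  compact (charfun @` F).

Definition regular_family (F : set (set nat)) : Prop :=
  [/\ F `<=` finite_set, spreading F, hereditary F & compact_family F].

Definition nice_family (F : set (set nat)) : Prop :=
  [/\ regular_family F,
      forall n, F [set n] &
      forall E, F E ->
        MAX F E \/ forall n, set_before E [set n] -> F (E `|` [set n])].

(* The derivatives decrease, so the intersection over the f n is the          *)
(* derivative of order sup_n (f n), whether or not the supremum is attained.  *)
Fixpoint derivative (F : set (set nat)) (a : ord) : set (set nat) :=
  match a with
  | Ozero => F
  | Osucc b => derivative F b `\` MAX (derivative F b)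
  | Osup f => \bigcap_n derivative F (f n)
  end.

Definition has_rank (F : set (set nat)) (a : ord) : Prop :=
  derivative F a = set0 /\ forall b, derivative F b = set0 -> ord_le a b.

(* M|F is the maximal initial segment of M belonging to F; this says E = M|F *)
Definition is_restriction (M : set nat) (F : set (set nat)) (E : set nat) :
    Prop :=
  MAX (F `&` [set G | initseg G M]) E.

(* --------------------------- Probability blocks --------------------------- *)

Section ProbabilityBlocks.
Variable K : realType.

Definition supp (p : probability nat K) : set nat :=
  [set i | p [set i] != 0%E].

(* P M n is only meaningful when M is infinite. *)
Record probability_block (P : set nat -> nat -> probability nat K)
    (F : set (set nat)) : Prop := {
  block_nice : nice_family F;
  block_first : forall M, infinite_set M ->
    is_restriction M F (supp (P M 0%N));
  block_shift : forall M N r, infinite_set M -> infinite_set N ->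
    proper_initseg (supp (P M r)) N -> forall A, P N 0%N A = P M r A;
  (* the supports of the P M n are a partition of M into successive members   *)
  (* of MAX F                                                                 *)
  block_max : forall M n, infinite_set M -> MAX F (supp (P M n));
  block_successive : forall M n, infinite_set M ->
    set_before (supp (P M n)) (supp (P M n.+1));
  block_cover : forall M, infinite_set M -> \bigcup_n supp (P M n) = M
}.

Definition sufficient (xi : ord) (P : set nat -> nat -> probability nat K) :
    Prop :=
  forall (F : set (set nat)) (a : ord),
    regular_family F -> has_rank F a -> ord_le a (omega_pow xi) ->
    forall (L : set nat) (eps : K), infinite_set L -> 0 < eps ->
    exists2 M, infsub L M &
      (ereal_sup [set P N 0%N E | N in infsub M & E in F] <= eps%:E)%E.

Definition homogeneous (xi : ord) (P : set nat -> nat -> probability nat K)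
    (F : set (set nat)) : Prop :=
  sufficient xi P /\ has_rank F (Osucc (omega_pow xi)).

Definition block_average (X : normedModType K)
    (P : set nat -> nat -> probability nat K) (M : set nat) (x : nat -> X) :
    nat -> X :=
  fun n => \sum_(i \in supp (P M n)) fine (P M n [set i]) *: x i.

End ProbabilityBlocks.

(* ---------------------------- Sequence spaces ----------------------------- *)

Section SequenceSpaces.
Variables (K : realType) (X : completeNormedModType K).

Definition linf_norm (x : nat -> X) : K := sup (range (fun n => `|x n|)).

(* x \otimes e_n *)
Definition tens (x : X) (n : nat) : nat -> X :=
  fun k => if k == n then x else 0.

Definition lin_span (V : lmodType K) (A : set V) : set V :=
  [set v | exists (n : nat) (a : 'I_n -> K) (w : 'I_n -> V),
     (forall i, A (w i)) /\ v = \sum_(i < n) a i *: w i].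

Definition c00 : set (nat -> X) :=
  @lin_span (nat -> X) [set v | exists x n, v = tens x n].

Definition linear_subspace (E : set (nat -> X)) : Prop :=
  [/\ E 0, forall x y, E x -> E y -> E (x + y) &
      forall (a : K) x, E x -> E (a *: x)].

Definition norm_on (E : set (nat -> X)) (r : (nat -> X) -> K) : Prop :=
  [/\ forall x, E x -> 0 <= r x,
      forall x, E x -> r x = 0 -> x = 0,
      forall (a : K) x, E x -> r (a *: x) = `|a| * r x &
      forall x y, E x -> E y -> r (x + y) <= r x + r y].

Definition complete_on (E : set (nat -> X)) (r : (nat -> X) -> K) : Prop :=
  forall u : nat -> nat -> X, (forall n, E (u n)) ->
    (forall eps : K, 0 < eps -> exists n0, forall n m,
       (n0 <= n)%N -> (n0 <= m)%N -> r (u n - u m) < eps) ->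
    exists2 v, E v & (fun n => r (u n - v)) @ \oo --> (0 : K).

Definition unit_ball (E : set (nat -> X)) (r : (nat -> X) -> K) :
    set (nat -> X) :=
  [set x | E x /\ r x <= 1].

Record subsequential_space (E : set (nat -> X)) (r : (nat -> X) -> K) :
    Prop := {
  subseq_subspace : linear_subspace E;
  subseq_norm : norm_on E r;
  subseq_complete : complete_on E r;
  subseq_c00 : c00 `<=` E;
  subseq_linf : E `<=` bounded_fun;
  subseq_ball : forall x, unit_ball E r x -> linf_norm x <= 1;
  subseq_subseq : forall x (phi : nat -> nat), unit_ball E r x ->
    {homo phi : i j / (i < j)%N} -> unit_ball E r (x \o phi)
}.

(* The terms of x with indices l, ..., m, the others being replaced by 0. *)
Definition segment (l m : nat) (x : nat -> X) : nat -> X :=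
  \sum_(l <= n < m.+1) tens (x n) n.

Record bimonotone_norm (s : (nat -> X) -> K) : Prop := {
  bimon_norm : norm_on c00 s;
  bimon_tens : forall x n, s (tens x n) = `|x|;
  bimon_sup : forall x, c00 x ->
    (s x)%:E = ereal_sup [set e | exists l m,
                            (l <= m)%N /\ e = (s (segment l m x))%:E];
  bimon_lim : forall x, c00 x -> (fun m => s (segment 0 m x)) @ \oo --> s x
}.

(* The extension of s to all sequences, with value +oo allowed. *)
Definition ext_norm (s : (nat -> X) -> K) (x : nat -> X) : \bar K :=
  ereal_sup (range (fun m => (s (segment 0 m x))%:E)).

Definition natural_domain (s : (nat -> X) -> K) : set (nat -> X) :=
  [set x | bounded_fun x /\ (ext_norm s x < +oo)%E].

(* C B_S *)
Definition domain_ball (s : (nat -> X) -> K) (C : K) : set (nat -> X) :=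
  [set x | natural_domain s x /\ (ext_norm s x <= C%:E)%E].

End SequenceSpaces.

(* Main.v *)
(* The measure of a block of N' = phi(N) is compared with the images under    *)
(* phi of the first measures P_{M,1}, for a sparse enumeration phi of a       *)
(* subset of L.  Let k be the least index of the block.  If a set A of larger *)
(* indices in the block is such that {k} U A contains no member of MAX F,     *)
(* then phi(A) lies in the link {H > k : {k} U H in F}; the link is regular   *)
(* of rank at most omega^xi, so by sufficiency phi(A) has small mass.         *)
(* Subtracting multiples of the images greedily therefore exhausts the        *)
(* measure of the block up to a small error, i.e. this measure is nearly a    *)
(* convex combination of images.  As s is convex in each coordinate, an upper *)
(* bound for all averages of the subsequence x o phi over subsets of some K   *)
(* yields one for all averages of x over subsets of phi(K).  This replaces    *)
(* "there is M" by "for every L there is M in [L]".                           *)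
(*   A gliding hump turns finiteness for all N into a uniform bound on a      *)
(* smaller set.  Uniformity over the unit ball is a Baire category argument:  *)
(* for some L, D and every M in [L], the sequences bounded by D on a member   *)
(* of [M] approximate the unit ball up to 1/2, so that every w in the ball is *)
(* a sum of v_i / 2^i with v_i bounded by D on M_i for a decreasing sequence  *)
(* (M_i); w is then bounded on a suitable diagonal set.                       *)

Require Import Defs.
From mathcomp Require Import all_boot all_order all_algebra.
From mathcomp Require Import all_classical all_reals all_analysis.
From mathcomp Require Import ring lra.

Set Implicit Arguments.
Unset Strict Implicit.
Unset Printing Implicit Defensive.

Import Order.TTheory GRing.Theory Num.Theory.
Import numFieldNormedType.Exports.

Local Open Scope classical_set_scope.
Local Open Scope ring_scope.

(** * Countable ordinals and ranks of links *)

(** Everything is expressed by [bounded_on]: all truncated norms of the averages of x along all N in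
    [M] are at most C. Apart from scaling and specialization, the equivalence has to bridge three
    gaps.

    From membership in S for each N to one constant for x: [uniform_bound]. If no constant works,
    blocks of worse and worse sets are spliced into a single set whose averages leave S.

    From one M to some M inside every L: [transfer]. Its map phi depends on L only, so the
    hypothesis can be applied to x o phi, and the set so obtained is carried back into L at the
    price of an additive constant. The core is [block_replacement], whose smallness assumptions are
    verified in [replaceable_blocks]. They come from [rank_link], by which links have rank at most
    omega^xi, and from [small_on_link].

    From a constant for each x to a constant for the unit ball: [uniform_bound_on_ball]. It iterates
    [bounded_approximation], a consequence of the Baire argument [bounded_dense_in_ball], and
    collects the pieces on one set by [diagonal_bound]. The input is boundedness inside every L, so
    the transfer comes first.

    Sets are cut and glued along blocks by [tail_block], [concat_blocks] and [splice_blocks]. *)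

Lemma ord_le_refl a : ord_le a a.
Proof.
elim: a => [|a IH|f IH]; [exact: ord_le_zero | exact: ord_le_succ |].
by apply: ord_le_sup_lub => n; exact: (ord_le_sup_ub (n := n)).
Qed.

Lemma ord_le_sup_inv f c : ord_le (Osup f) c -> forall n, ord_le (f n) c.
Proof.
move=> H; have [a Ea] : {a | a = Osup f} by exists (Osup f).
rewrite -Ea in H; elim: H f Ea => // [g b H _ f [<-] //|b g n' _ IH f Eb n].
by apply: ord_le_sup_ub; exact: IH.
Qed.

Lemma ord_le_trans a b c : ord_le a b -> ord_le b c -> ord_le a c.
Proof.
move=> H; elim: H c => {a b} [b c _|a b _ IH c Hc|f b _ IH c Hc|a f n _ IH c Hc].
- exact: ord_le_zero.
- have [d Ed] : {d | d = Osucc b} by exists (Osucc b).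
  rewrite -Ed in Hc; elim: Hc Ed => // [b1 c1 H1 _ [E1]|b1 g n _ IH1 E1].
  + by apply: ord_le_succ; apply: IH; rewrite -E1.
  + by apply: ord_le_sup_ub; exact: IH1.
- by apply: ord_le_sup_lub => n; exact: IH.
- by apply: IH; exact: ord_le_sup_inv Hc n.
Qed.

Lemma ord_le_succ_self a : ord_le a (Osucc a).
Proof.
elim: a => [|a IH|f IH]; [exact: ord_le_zero | exact: ord_le_succ |].
apply: ord_le_sup_lub => n; apply: (ord_le_trans (IH n)).
by apply: ord_le_succ; exact: (ord_le_sup_ub (ord_le_refl _)).
Qed.

Lemma ord_le_succ_inv a b : ord_le (Osucc a) (Osucc b) -> ord_le a b.
Proof. by move=> H; inversion H. Qed.

Lemma ord_lt_or_ge a c : ord_le (Osucc a) c \/ ord_le c a.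
Proof.
elim: c a => [a|c IHc a|f IHf a]; first by right; exact: ord_le_zero.
- elim: a => [|a _|g IHg].
  + by left; apply: ord_le_succ; exact: ord_le_zero.
  + by have [H|H] := IHc a; [left|right]; exact: ord_le_succ.
  + have [[n Hn]|H] := EM (exists n, ord_le (Osucc c) (g n)).
      by right; exact: ord_le_sup_ub Hn.
    left; apply: ord_le_succ; apply: ord_le_sup_lub => n.
    by have [/ord_le_succ_inv//|Hn] := IHg n; case: H; exists n.
- have [[n Hn]|H] := EM (exists n, ord_le (Osucc a) (f n)).
    by left; exact: ord_le_sup_ub Hn.
  right; apply: ord_le_sup_lub => n.
  by have [Hn|//] := IHf n a; case: H; exists n.
Qed.

(** Well-foundedness, in a form that admits induction on the notation a: at a supremum, if no stage
    finds a least element, every stage is a lower bound. It supplies the least ordinal that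
    [has_rank] asks for. *)
Lemma ord_least (Q : ord -> Prop) a :
  (exists b, [/\ ord_le b a, Q b & forall c, Q c -> ord_le b c]) \/
  (forall c, Q c -> ord_le a c).
Proof.
elim: a => [|a [[b [ba Qb bm]]|IH]|f IH].
- by right => c _; exact: ord_le_zero.
- left; exists b; split=> //.
  exact: ord_le_trans ba (ord_le_succ_self a).
- have [H|] := EM (forall c, Q c -> ord_le (Osucc a) c); first by right.
  move=> /existsNP[c /not_implyP[Qc Nc]]; left; exists c.
  have [//|ca] := ord_lt_or_ge a c; split=> //.
  + exact: ord_le_trans ca (ord_le_succ_self a).
  + by move=> d /IH; exact: ord_le_trans.
- have [[n [b [bf Qb bm]]]|H] :=
    EM (exists n b, [/\ ord_le b (f n), Q b & forall c, Q c -> ord_le b c]).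
    by left; exists b; split=> //; exact: ord_le_sup_ub bf.
  right => c Qc; apply: ord_le_sup_lub => n.
  have [[b Hb]|Hn] := IH n; last exact: Hn.
  by case: H; exists n, b.
Qed.

Lemma has_rank_le (F : set (set nat)) a :
  derivative F a = set0 -> exists2 b, has_rank F b & ord_le b a.
Proof.
move=> Fa; have [[b [ba Fb bm]]|H] := ord_least (fun c => derivative F c = set0) a.
  by exists b.
by exists a; [split | exact: ord_le_refl].
Qed.

Lemma initseg_set0 E : initseg set0 E. Proof. by split. Qed.

Lemma initseg_total E G H : initseg E H -> initseg G H -> E `<=` G \/ G `<=` E.
Proof.
move=> [EH EHi] [GH GHi]; have [|] := EM (E `<=` G); first by left.
move=> /existsNP[x /not_implyP[Ex nGx]]; right => y Gy.
case: (leqP x y) => [xy|/ltnW yx]; first by case: nGx; apply: GHi Gy xy; exact: EH.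
by apply: EHi Ex yx; exact: GH.
Qed.

Lemma initseg_sub E G H : initseg E H -> initseg G H -> E `<=` G -> initseg E G.
Proof.
move=> [EH EHi] [GH _] EG; split=> // x y Gx; apply: EHi; exact: GH.
Qed.

Lemma max_initseg_eq F E G H : MAX F E -> MAX F G -> initseg E H ->
  initseg G H -> E = G.
Proof.
move=> [FE mE] [FG mG] EH GH; have [EG|GE] := initseg_total EH GH.
  by rewrite (mE _ FG (initseg_sub EH GH EG)).
by rewrite (mG _ FE (initseg_sub GH EH GE)).
Qed.

Lemma derivative_sub F a : derivative F a `<=` F.
Proof.
by elim: a => [|a IH|f IH] //= E; [case=> /IH | move=> /(_ 0 I) /IH].
Qed.

(** Maximality refers to initial segments: a maximal G below a member E must be E itself, so
    removing maximal members keeps closure under initial segments. *)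
Lemma derivative_initseg F a : hereditary F ->
  forall E G, derivative F a E -> initseg G E -> derivative F a G.
Proof.
move=> hF; elim: a => [|a IH|f IH] /= E G.
- by move=> FE [GE _]; exact: hF FE GE.
- move=> [DE nmE] GE; split; first exact: IH DE GE.
  move=> mG; apply: nmE; have EG := mG.2 _ DE GE.
  by rewrite EG.
- by move=> H GE n _; exact: IH (H n I) GE.
Qed.

Definition link (F : set (set nat)) (n : nat) : set (set nat) :=
  [set H | set_before [set n] H /\ F ([set n] `|` H)].

Lemma link_sub F n : hereditary F -> link F n `<=` F.
Proof. by move=> hF H [_ /hF]; apply => x; right. Qed.

Lemma initseg_setU1 n E G : set_before [set n] E -> set_before [set n] G ->
  initseg E G -> initseg ([set n] `|` E) ([set n] `|` G).
Proof.
move=> nE nG [EG EGi]; split; first exact: setUS.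
move=> x y [->|Gx]; first by left.
move=> [->|Ey] xy; first by have := nG n x erefl Gx; rewrite ltnNge xy.
by right; exact: EGi Ey xy.
Qed.

Lemma setU1_inj n E G : set_before [set n] E -> set_before [set n] G ->
  [set n] `|` E = [set n] `|` G -> E = G.
Proof.
have sub A B : set_before [set n] A -> [set n] `|` A = [set n] `|` B -> A `<=` B.
  move=> nA AB x Ax; have : ([set n] `|` B) x by rewrite -AB; right.
  by case=> // xn; have := nA n x erefl Ax; rewrite xn ltnn.
move=> nE nG EG; apply/seteqP; split; first exact: sub EG.
exact: sub (esym EG).
Qed.

(** Any extension of H inside a derivative of the link becomes, with n put back, an extension of {n}
    U H inside the same derivative of F. *)
Lemma derivative_link F n a H :
  derivative (link F n) a H -> derivative F a ([set n] `|` H).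
Proof.
elim: a H => [H [] //|a IH H /= [DH nmH]|f IH H /= DH k _]; last exact: IH (DH k I).
split; first exact: IH.
move=> [_ mH]; apply: nmH; split=> // G DG HG.
have [nH _] := derivative_sub DH; have [nG _] := derivative_sub DG.
by apply: (setU1_inj nG nH); apply: mH; [exact: IH | exact: initseg_setU1 nH nG HG].
Qed.

(** If the derivative of order a of the link had a member H, then {n} U H, hence also its initial
    segment the empty set, would lie in the derivative of F of order a. The empty set is not maximal
    there, so it would survive one step more. For F of rank omega^xi + 1 this brings all links
    within reach of [sufficient]. *)
Lemma rank_link F a n : hereditary F -> derivative F (Osucc a) = set0 ->
  exists2 b, has_rank (link F n) b & ord_le b a.
Proof.
move=> hF Fa; apply: has_rank_le; apply/seteqP; split=> // H /derivative_link DH.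
have D0 : derivative F a set0 := derivative_initseg hF DH (initseg_set0 _).
suff : derivative F (Osucc a) set0 by rewrite Fa.
split=> // -[_ /(_ _ DH (initseg_set0 _)) H0].
by have : ([set n] `|` H) n; [left | rewrite H0].
Qed.

Lemma finite_set_sorted (E : set nat) : finite_set E ->
  exists2 m : seq nat, sorted ltn m & E = [set` m].
Proof.
move=> /finite_seqP[s ->]; exists (sort leq (undup s)).
  by rewrite ltn_sorted_uniq_leq sort_uniq undup_uniq sort_sorted //; exact: leq_total.
by apply/seteqP; split=> x /=; rewrite mem_sort mem_undup.
Qed.

Lemma spreading_image F (f : nat -> nat) E : F `<=` finite_set -> spreading F ->
  {homo f : i j / (i < j)%N} -> (forall i, (i <= f i)%N) -> F E -> F (f @` E).
Proof.
move=> fF sF fi fge FE; have [m sm Em] := finite_set_sorted (fF _ FE).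
have -> : f @` E = [set` map f m].
  rewrite Em; apply/seteqP; split=> x /=.
    by move=> [y ym <-]; exact: map_f.
  by move=> /mapP[y ym ->]; exists y.
apply: (sF m) => //; last by rewrite -Em.
  exact: homo_sorted sm.
by elim: m {sm Em} => //= x m ->; rewrite fge.
Qed.

(** The link is a closed subset of Cantor space: it is the preimage of a closed set under the
    continuous operation of adding n, intersected with the conditions that the coordinates up to n
    vanish. *)
Lemma compact_link F n : compact_family F -> compact_family (link F n).
Proof.
move=> cF; pose f (p : cantor_space) : cantor_space := fun i => (i == n) || p i.
have fc : continuous f.
  move=> p; apply/cvg_sup => i U [_ [[W oW <-] /= Wi] /filterS]; apply.
  suff : nbhs (p : cantor_space) [set q : cantor_space | W (f q i)] by [].
  have [Ein|ni] := eqVneq i n.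
    apply: filterS filterT => q _; move: Wi.
    by rewrite /f /= Ein eqxx.
  have : nbhs (p i) W by apply: open_nbhs_nbhs; split=> //; move: Wi; rewrite /f (negbTE ni).
  move=> /(@proj_continuous _ (fun=> bool) i p) H.
  have -> // : [set q : cantor_space | W (f q i)] = proj i @^-1` W.
  by apply/funext => q; rewrite /f /proj /= (negbTE ni).
have fclosed : closed (charfun @` F) := compact_closed cantor_space_hausdorff cF.
pose Z k := [set p : cantor_space | p k = false].
have Zc k : closed (Z k).
  suff : closed ((fun p : cantor_space => p k) @^-1` [set false]) by [].
  apply: preimage_closed; first by move=> q _; exact: (@proj_continuous _ (fun=> bool) k q).
  by apply: compact_closed; [exact: discrete_hausdorff | exact: compact_set1].
rewrite /compact_family; have -> : charfun @` link F n =
    (f @^-1` (charfun @` F)) `&` \bigcap_(k in [set k | (k <= n)%N]) Z k.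
  apply/seteqP; split=> [_ [H [nH FH] <-]|p [[E FE fE] pn]].
    split; last first.
      by move=> k kn; apply/asboolPn => /(nH _ _ erefl); rewrite ltnNge kn.
    exists ([set n] `|` H) => //; apply/funext => i; rewrite /f /charfun /=.
    by apply/asboolP/orP => -[/eqP|/asboolP]; [left|right|left|right].
  have pE i : p i -> E i.
    by move=> pi; apply/asboolP; have := congr1 (@^~ i) fE; rewrite /charfun /f pi orbT.
  exists [set i | p i]; last by apply/funext => i; apply/asboolP/idP.
  have nE : E n.
    by apply/asboolP; have := congr1 (@^~ n) fE; rewrite /charfun /f eqxx.
  have Ep i : E i -> i <> n -> p i.
    move=> Ei /eqP ni; have := congr1 (@^~ i) fE; rewrite /charfun /f (negbTE ni) /=.
    by move=> <-; apply/asboolP.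
  split.
    move=> _ y -> py; rewrite ltnNge; apply/negP => /pn; rewrite /Z /= => pyF.
    by move: py; rewrite /= pyF.
  rewrite (_ : _ `|` _ = E) //; apply/seteqP; split=> [i [->//|/pE//]|i Ei].
  by have [->|/eqP ni] := eqVneq i n; [left | right; exact: Ep].
apply: (subclosed_compact _ cantor_space_compact) => //.
apply: closedI; last by apply: closed_bigI.
by apply: preimage_closed => // q _; exact: fc.
Qed.

Lemma regular_link F n : regular_family F -> regular_family (link F n).
Proof.
move=> [fF sF hF cF]; split.
- by move=> H /(link_sub hF) /fF.
(* Spreading of F is applied to n :: m and n :: l; l stays above n because its first entry is at
   least that of m. *)
- move=> m l sm sl ml [nm Fm]; have nl : set_before [set n] [set` l].
    move=> x y -> /= yl; case: l m sl ml yl sm nm {Fm} => [|b l] [|a m] //=.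
    move=> sl /andP[ab _] yl _ nm.
    apply: (@leq_trans a); first by apply: nm => //=; rewrite inE eqxx.
    apply: (leq_trans ab); move: yl; rewrite inE => /predU1P[->//|yl].
    by have /allP/(_ _ yl)/ltnW := order_path_min ltn_trans sl.
  split=> //.
  have cons s : [set n] `|` [set` s] = [set` n :: s].
    apply/seteqP; split=> x /=; rewrite inE.
      by move=> [->|xs]; [rewrite eqxx | rewrite xs orbT].
    by move=> /predU1P[->|]; [left | right].
  have path_cons s : set_before [set n] [set` s] -> sorted ltn s -> sorted ltn (n :: s).
    case: s => //= a s H; rewrite H ?//= ?inE ?eqxx //.
  rewrite cons; rewrite cons in Fm; apply: (sF (n :: m)) => //.
  + exact: path_cons.
  + exact: path_cons.
  + by rewrite /= leqnn.
- move=> E G [nE FE] GE; split; first by move=> x y xn /GE; exact: nE.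
  by apply: hF FE _; exact: setUS.
- exact: compact_link.
Qed.

(** * Blocks of an infinite set *)

Lemma infinite_natP (A : set nat) :
  infinite_set A <-> forall n, exists2 m, A m & (n <= m)%N.
Proof.
split=> [Ainf n|H].
  have [m [Am nm]] := infinite_setN0 (infinite_setD Ainf (finite_II n)).
  by exists m => //; rewrite leqNgt; apply/negP.
move=> /finite_seqP[s As]; have [m] := H (\max_(i <- s) i).+1.
rewrite As => ms; rewrite ltnNge => /negP; apply.
exact: (@leq_bigmax_seq _ s xpredT id m ms isT).
Qed.

Lemma finite_nat_bound (A : set nat) : finite_set A ->
  exists n, forall i, A i -> (i < n)%N.
Proof.
move=> /finite_seqP[s As]; exists (\max_(i <- s) i).+1 => i.
by rewrite As ltnS => si; exact: (@leq_bigmax_seq _ s xpredT id i si isT).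
Qed.

Lemma infinite_above (M : set nat) n : infinite_set M ->
  infinite_set (M `&` [set i | (n < i)%N]).
Proof.
move=> /infinite_natP H; apply/infinite_natP => k.
have [m Mm] := H (maxn n.+1 k); rewrite geq_max => /andP[nm km].
by exists m.
Qed.

Lemma nat_least (A : set nat) : A !=set0 ->
  exists2 m, A m & forall i, A i -> (m <= i)%N.
Proof.
move=> [a Aa]; have : exists n, `[< A n >] by exists a; apply/asboolP.
by move=> /ex_minnP[m /asboolP Am mm]; exists m => // i Ai; apply: mm; apply/asboolP.
Qed.

Lemma set_before_bigcup (Q : nat -> set nat) : (forall i, Q i !=set0) ->
  (forall i, set_before (Q i) (Q i.+1)) ->
  forall i j, (i < j)%N -> set_before (Q i) (Q j).
Proof.
move=> Q0 Qs i j; elim: j => // j IH; rewrite ltnS leq_eqVlt => /predU1P[->//|ij].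
move=> x y Qx Qy; have [z Qz] := Q0 j.
exact: ltn_trans (IH ij x z Qx Qz) (Qs j z y Qz Qy).
Qed.

Lemma set_before_ge (Q : nat -> set nat) : (forall i, Q i !=set0) ->
  (forall i, set_before (Q i) (Q i.+1)) -> forall i x, Q i x -> (i <= x)%N.
Proof.
move=> Q0 Qs; elim=> // i IH x Qx; have [z Qz] := Q0 i.
exact: leq_ltn_trans (IH z Qz) (Qs i z x Qz Qx).
Qed.

Definition tail_union (Q : nat -> set nat) (j : nat) : set nat :=
  \bigcup_(i in [set i | (j <= i)%N]) Q i.

Lemma infinite_tail_union (Q : nat -> set nat) j : (forall i, Q i !=set0) ->
  (forall i, set_before (Q i) (Q i.+1)) -> infinite_set (tail_union Q j).
Proof.
move=> Q0 Qs; apply/infinite_natP => n; have [x Qx] := Q0 (j + n)%N.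
exists x; first by exists (j + n)%N => //=; exact: leq_addr.
exact: leq_trans (leq_addl j n) (set_before_ge Q0 Qs Qx).
Qed.

Lemma tail_union_initseg (Q : nat -> set nat) j : (forall i, Q i !=set0) ->
  (forall i, set_before (Q i) (Q i.+1)) ->
  proper_initseg (Q j) (tail_union Q j).
Proof.
move=> Q0 Qs; split.
  split; first by move=> x Qx; exists j => /=.
  move=> x y [i /= ji Qx] Qy xy; move: ji; rewrite leq_eqVlt => /predU1P[->//|ji].
  by have := set_before_bigcup Q0 Qs ji Qy Qx; rewrite ltnNge xy.
move=> E; have [x Qx] := Q0 j.+1; have : tail_union Q j x by exists j.+1 => /=.
by rewrite -E => Qjx; have := Qs j x x Qjx Qx; rewrite ltnn.
Qed.

Lemma tail_unionS (Q : nat -> set nat) j : (forall i, Q i !=set0) ->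
  (forall i, set_before (Q i) (Q i.+1)) ->
  tail_union Q j.+1 = tail_union Q j `\` Q j.
Proof.
move=> Q0 Qs; apply/seteqP; split=> [x [i /= ji Qx]|x [[i /= ji Qx] nQ]].
  split; first by exists i => //=; exact: ltnW.
  by move=> Qjx; have := set_before_bigcup Q0 Qs ji Qjx Qx; rewrite ltnn.
exists i => //=; move: ji; rewrite leq_eqVlt => /predU1P[ji|//].
by case: nQ; rewrite ji.
Qed.

(** The first pieces are maximal members and initial segments of the same set, hence equal; removing
    them reproduces the situation. *)
Lemma successive_max_unique F (Q Q' : nat -> set nat) :
  (forall i, Q i !=set0) -> (forall i, Q' i !=set0) ->
  (forall i, set_before (Q i) (Q i.+1)) ->
  (forall i, set_before (Q' i) (Q' i.+1)) ->
  (forall i, MAX F (Q i)) -> (forall i, MAX F (Q' i)) ->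
  tail_union Q 0 = tail_union Q' 0 -> forall i, Q i = Q' i.
Proof.
move=> Q0 Q0' Qs Qs' mQ mQ' QQ' i.
suff : tail_union Q i = tail_union Q' i.
  move=> E; have [Ii _] := tail_union_initseg i Q0 Qs.
  have [Ii' _] := tail_union_initseg i Q0' Qs'.
  by apply: (max_initseg_eq (mQ i) (mQ' i) Ii); rewrite E.
elim: i => // i E; have [Ii _] := tail_union_initseg i Q0 Qs.
have [Ii' _] := tail_union_initseg i Q0' Qs'.
have QE : Q i = Q' i by apply: (max_initseg_eq (mQ i) (mQ' i) Ii); rewrite E.
by rewrite !tail_unionS // E QE.
Qed.

Section Blocks.
Variables (K : realType) (P : set nat -> nat -> probability nat K).
Variable F : set (set nat).
Hypothesis blockP : probability_block P F.

Let sp N j := supp (P N j).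

Lemma block_hereditary : hereditary F.
Proof. by have [[_ _ ? _] _ _] := block_nice blockP. Qed.

Lemma max_nonempty E : MAX F E -> E !=set0.
Proof.
move=> [_ mE]; apply: contrapT => /set0P/negP/negPn/eqP E0.
have [_ F1 _] := block_nice blockP.
have : [set 0%N] = E by apply: mE (F1 0%N) _; rewrite E0; exact: initseg_set0.
by rewrite E0 => E1; have : [set 0%N] 0%N by []; rewrite E1.
Qed.

Lemma supp_nonempty N j : infinite_set N -> sp N j !=set0.
Proof. by move=> iN; apply: max_nonempty; exact: (block_max blockP). Qed.

Lemma supp_member N j : infinite_set N -> F (sp N j).
Proof. by move=> iN; have [] := block_max blockP j iN. Qed.

Lemma supp_finite N j : infinite_set N -> finite_set (sp N j).
Proof.
move=> iN; have [[fF _ _ _] _ _] := block_nice blockP.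
by apply: fF; exact: supp_member.
Qed.

Lemma supp_sub N j : infinite_set N -> sp N j `<=` N.
Proof. by move=> iN x Nx; rewrite -(block_cover blockP iN); exists j. Qed.

Lemma supp_lt N i j : infinite_set N -> (i < j)%N -> set_before (sp N i) (sp N j).
Proof.
move=> iN; apply: (@set_before_bigcup (sp N)) => k; first exact: supp_nonempty.
exact: (block_successive blockP).
Qed.

Lemma supp0_initseg N : infinite_set N -> initseg (sp N 0) N.
Proof.
move=> iN; have [] := @tail_union_initseg (sp N) 0.
- by move=> i; exact: supp_nonempty.
- by move=> i; exact: (block_successive blockP).
suff -> : tail_union (sp N) 0 = N by [].
by rewrite -[RHS](block_cover blockP iN); apply/seteqP; split=> x [i _ Hx]; exists i.
Qed.

Lemma supp_eq (p q : probability nat K) : (forall A, p A = q A) -> supp p = supp q.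
Proof. by move=> pq; apply/seteqP; split=> x; rewrite /supp /= pq. Qed.

(** By [block_shift], the measure number j of the union and the first measure of M j both equal the
    first measure of the tail formed by the chosen supports from number j on. So first blocks may be
    taken from unrelated sets as long as they are successive. *)
Lemma concat_blocks (M : nat -> set nat) : (forall j, infinite_set (M j)) ->
  (forall j, set_before (sp (M j) 0) (sp (M j.+1) 0)) ->
  infinite_set (\bigcup_j sp (M j) 0) /\
  forall j A, P (\bigcup_j sp (M j) 0) j A = P (M j) 0 A.
Proof.
move=> iM Ms; pose Q j := sp (M j) 0; set N := \bigcup_j _.
have Q0 j : Q j !=set0 by exact: supp_nonempty.
have NE : tail_union Q 0 = N by apply/seteqP; split=> x [i _ Qx]; exists i.
have iN : infinite_set N by rewrite -NE; exact: infinite_tail_union.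
split=> // j A; have suppE : sp N j = Q j.
  apply: (@successive_max_unique F) => [i||i||i|i|] //.
  - exact: supp_nonempty.
  - exact: (block_successive blockP).
  - exact: (block_max blockP).
  - exact: (block_max blockP).
  rewrite NE -[RHS](block_cover blockP iN).
  by apply/seteqP; split=> x [i _ Qx]; exists i.
have iT := infinite_tail_union (j := j) Q0 Ms.
have pT := tail_union_initseg j Q0 Ms.
have pN : proper_initseg (supp (P N j)) (tail_union Q j) by rewrite -[supp _]/(sp N j) suppE.
rewrite -(block_shift blockP iN iT pN).
exact: (block_shift blockP (iM j) iT pT).
Qed.

(** Makes an arbitrary block a first block, the only kind about which [sufficient] speaks. *)
Lemma tail_block N j : infinite_set N ->
  [/\ infinite_set (tail_union (sp N) j), tail_union (sp N) j `<=` N &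
      forall A, P (tail_union (sp N) j) 0 A = P N j A].
Proof.
move=> iN; have Q0 i : sp N i !=set0 by exact: supp_nonempty.
have Qs i : set_before (sp N i) (sp N i.+1) by exact: (block_successive blockP).
have iT := infinite_tail_union (j := j) Q0 Qs.
split=> //; first by move=> x [i _]; exact: supp_sub.
exact: (block_shift blockP iN iT (tail_union_initseg j Q0 Qs)).
Qed.

(** Each of the blocks before number i uses up at least one value of f before f c. *)
Lemma block_index_le (f : nat -> nat) N i c : {homo f : i j / (i < j)%N} ->
  infinite_set N -> N `<=` range f -> sp N i (f c) -> (i <= c)%N.
Proof.
move=> fi iN Nf; apply: (@set_before_ge (fun i => [set c | sp N i (f c)])) => j.
  have [a Na] := supp_nonempty j iN.
  by have [b _ ba] := Nf a (supp_sub iN Na); exists b; rewrite /= ba.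
move=> a b /= Na Nb; have fab := @block_successive _ _ _ blockP N j iN _ _ Na Nb.
rewrite ltnNge; apply/negP; rewrite leq_eqVlt => /predU1P[ba|/fi/ltnW].
  by move: fab; rewrite ba ltnn.
by rewrite leqNgt fab.
Qed.

(** Blocks keep their numbers: once the order condition of [splice_blocks] holds, averages along the
    splice agree with those along N in the coordinates before p and with those along N' from p
    on. *)
Definition splice (N N' : set nat) (p : nat) : set nat :=
  \bigcup_j sp (if (j < p)%N then N else N') j.

Lemma splice_blocks N N' p : infinite_set N -> infinite_set N' ->
  (forall j, (j < p)%N -> set_before (sp N j) (sp N' p)) ->
  [/\ infinite_set (splice N N' p),
      forall j A, (j < p)%N -> P (splice N N' p) j A = P N j A &
      forall j A, (p <= j)%N -> P (splice N N' p) j A = P N' j A].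
Proof.
move=> iN iN' NN'; pose L j := if (j < p)%N then N else N'.
have iL j : infinite_set (L j) by rewrite /L; case: ifP.
pose M j := tail_union (sp (L j)) j.
have ML j A : P (M j) 0 A = P (L j) j A by have [_ _] := tail_block j (iL j).
have spM j : sp (M j) 0 = sp (L j) j by apply: supp_eq.
have iM j : infinite_set (M j) by have [] := tail_block j (iL j).
have [|iS PS] := concat_blocks iM.
  move=> j; rewrite !spM /L; have [jp|jp] := ltnP j.+1 p.
    by rewrite (ltnW jp); exact: (block_successive blockP).
  move: jp; rewrite leq_eqVlt => /predU1P[jp|]; last first.
    by rewrite ltnS leqNgt => /negbTE ->; exact: (block_successive blockP).
  by rewrite -jp leqnn; apply: NN'; rewrite jp.
have -> : splice N N' p = \bigcup_j sp (M j) 0.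
  by apply: eq_bigcupr => j _; rewrite spM.
split=> // j A jp; rewrite PS ML /L ?jp //.
by rewrite ltnNge jp.
Qed.

End Blocks.

(** * Averages and bimonotone norms *)

Section Weights.
Variables (K : realType) (p : probability nat K).

Definition weight (i : nat) : K := fine (p [set i]).

Lemma weight_ge0 i : 0 <= weight i.
Proof. by apply: fine_ge0; exact: measure_ge0. Qed.

Lemma prob_fin_num (A : set nat) : p A \is a fin_num.
Proof. by apply: fin_num_measure. Qed.

Lemma suppE i : supp p i <-> weight i != 0.
Proof.
rewrite /supp /weight /=; have /fineK := prob_fin_num [set i].
by move=> <-; rewrite /= eqe.
Qed.

Lemma sum_weight (D : set nat) n : D `<=` [set i | (i < n)%N] ->
  \sum_(i < n | `[< D i >]) weight i = fine (p D).
Proof.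
elim: n D => [|n IH] D Dn.
  rewrite big_ord0 (_ : D = set0) ?measure0 //.
  by apply/seteqP; split=> // x /Dn.
have Dn' : D `\` [set n] `<=` [set i | (i < n)%N].
  by move=> i [/Dn /=]; rewrite ltnS leq_eqVlt => /predU1P[].
rewrite big_mkcond big_ord_recr /= -big_mkcond /=.
have -> : \sum_(i < n | `[< D i >]) weight i = fine (p (D `\` [set n])).
  rewrite -IH //; apply: eq_bigl => i; apply/asboolP/asboolP => [Di|[]//].
  by split=> // /= ni; have := ltn_ord i; rewrite ni ltnn.
case: asboolP => Dn1; last first.
  rewrite addr0; congr (fine (p _)); apply/seteqP; split=> [i []//|i Di].
  by split=> // ni; apply: Dn1; rewrite -ni.
rewrite -fineD ?prob_fin_num // -measureU //; last first.
  by apply/seteqP; split=> // i [[]].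
congr (fine (p _)); apply/seteqP; split=> [i [[]//|->//]|i Di].
by have [->|/eqP ni] := eqVneq i n; [right | left].
Qed.

Lemma prob_setC_supp : p (~` supp p) = 0%E.
Proof.
have : p.-negligible (\bigcup_i ([set i] `\` supp p)).
  apply: negligible_bigcup => i; apply/negligibleP => //.
  case: (EM (supp p i)) => [si|/negP]; last first.
    rewrite negbK => /eqP p0; rewrite (_ : _ `\` _ = [set i]) //.
    by apply/seteqP; split=> [j []//|j ->]; split=> //; rewrite /supp /= p0 eqxx.
  rewrite (_ : _ `\` _ = set0) ?measure0 //.
  by apply/seteqP; split=> // j [->].
move=> /negligibleP => <- //; congr (p _).
by apply/seteqP; split=> [i si|i [j _ [->]]] //; exists i.
Qed.

Lemma sum_weight_supp n : supp p `<=` [set i | (i < n)%N] -> \sum_(i < n) weight i = 1.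
Proof.
move=> sn; have -> : \sum_(i < n) weight i = \sum_(i < n | `[< supp p i >]) weight i.
  rewrite [RHS]big_mkcond; apply: eq_bigr => i _; case: asboolP => // /suppE/negP.
  by rewrite negbK => /eqP.
rewrite sum_weight // -[RHS]/(fine 1%:E) -(probability_setT p).
have : p (supp p `|` ~` supp p) = (p (supp p) + p (~` supp p))%E.
  by rewrite measureU // setICr.
by rewrite prob_setC_supp adde0 setUv => ->.
Qed.

End Weights.

Section Average.
Variables (K : realType) (X : completeNormedModType K).
Implicit Types (p q : probability nat K) (x y : nat -> X).

(** A function of a single measure, to which each coordinate of [block_average] is convertible. *)
Definition average p x : X := \sum_(i \in supp p) weight p i *: x i.

Lemma average_eq p q x : (forall A, p A = q A) -> average p x = average q x.
Proof.
move=> pq; rewrite /average (supp_eq pq).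
by apply: eq_fsbigr => i _; rewrite /weight pq.
Qed.

Lemma averageE p n x : supp p `<=` [set i | (i < n)%N] ->
  average p x = \sum_(i < n) weight p i *: x i.
Proof.
move=> sn; rewrite (fsbig_ord _ _ (fun i => weight p i *: x i)); apply: fsbig_widen => //.
move=> i [_ /= /suppE/negP]; rewrite negbK => /eqP w0.
by rewrite /= w0 scale0r.
Qed.

Lemma averageD p x y : finite_set (supp p) ->
  average p (x + y) = average p x + average p y.
Proof.
move=> /finite_nat_bound[n sn]; rewrite !(averageE _ sn) -big_split /=.
by apply: eq_bigr => i _; rewrite -scalerDr.
Qed.

Lemma averageZ p (a : K) x : finite_set (supp p) ->
  average p (a *: x) = a *: average p x.
Proof.
move=> /finite_nat_bound[n sn]; rewrite !(averageE _ sn) scaler_sumr.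
by apply: eq_bigr => i _; rewrite !scalerA mulrC.
Qed.

Lemma average_le p x (B : K) : finite_set (supp p) -> (forall i, `|x i| <= B) ->
  `|average p x| <= B.
Proof.
move=> /finite_nat_bound[n sn] xB; rewrite (averageE _ sn).
apply: le_trans (ler_norm_sum _ _ _) _.
rewrite -[leRHS]mul1r -(sum_weight_supp sn) mulr_suml.
apply: ler_sum => i _; rewrite normrZ ger0_norm ?weight_ge0 //.
by rewrite ler_wpM2l // weight_ge0.
Qed.

End Average.

Section BimonotoneNorm.
Variables (K : realType) (X : completeNormedModType K).
Variables (s : (nat -> X) -> K) (bimon_s : bimonotone_norm s).
Implicit Types (x y w : nat -> X).

Definition fin_supp w := exists n, forall k, (n <= k)%N -> w k = 0.

Lemma fin_supp0 : fin_supp 0. Proof. by exists 0%N. Qed.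

Lemma fin_suppD x y : fin_supp x -> fin_supp y -> fin_supp (x + y).
Proof.
move=> [n xn] [m ym]; exists (maxn n m) => k; rewrite geq_max => /andP[nk mk].
by rewrite fctE xn // ym // addr0.
Qed.

Lemma fin_suppZ (a : K) x : fin_supp x -> fin_supp (a *: x).
Proof. by move=> [n xn]; exists n => k nk; rewrite fctE xn // scaler0. Qed.

Lemma fin_supp_tens (t : X) j : fin_supp (tens t j).
Proof. by exists j.+1 => k jk; rewrite /tens gtn_eqF. Qed.

Lemma fin_supp_c00 w : fin_supp w -> c00 w.
Proof.
move=> [n wn]; exists n, (fun=> 1), (fun i => tens (w i) i).
split; first by move=> i; exists (w i), i.
apply/funext => k; rewrite fct_sumE.
have [kn|nk] := ltnP k n; last first.
  rewrite wn // big1 // => i _; rewrite fctE /tens gtn_eqF ?scaler0 //.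
  exact: (leq_trans (ltn_ord i) nk).
rewrite (bigD1 (Ordinal kn)) //= big1 ?addr0.
  by rewrite fctE /tens eqxx scale1r.
move=> i ik; rewrite fctE /tens; case: eqP => [E|]; last by rewrite scaler0.
by case/eqP: ik; apply: val_inj; rewrite /= E.
Qed.

Lemma snorm_ge0 w : fin_supp w -> 0 <= s w.
Proof. by move=> fw; have [H _ _ _] := bimon_norm bimon_s; exact/H/fin_supp_c00. Qed.

Lemma snormD x y : fin_supp x -> fin_supp y -> s (x + y) <= s x + s y.
Proof.
by move=> fx fy; have [_ _ _ H] := bimon_norm bimon_s; apply: H; exact: fin_supp_c00.
Qed.

Lemma snormZ (a : K) x : fin_supp x -> s (a *: x) = `|a| * s x.
Proof.
by move=> fx; have [_ _ H _] := bimon_norm bimon_s; apply: H; exact: fin_supp_c00.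
Qed.

Lemma snorm0 : s 0 = 0.
Proof. by rewrite -(scale0r (0 : nat -> X)) (snormZ _ fin_supp0) normr0 mul0r. Qed.

Lemma snorm_tens (t : X) j : s (tens t j) = `|t|.
Proof. exact: (bimon_tens bimon_s). Qed.

Definition trunc m x : nat -> X := fun k => if (k < m)%N then x k else 0.

Lemma fin_supp_trunc m x : fin_supp (trunc m x).
Proof. by exists m => k mk; rewrite /trunc ltnNge mk. Qed.

Lemma trunc0 x : trunc 0 x = 0. Proof. by []. Qed.

Lemma truncS m x : trunc m.+1 x = trunc m x + tens (x m) m.
Proof.
apply/funext => k; rewrite !fctE /trunc /tens ltnS.
by case: ltngtP => [||->]; rewrite ?addr0 ?add0r.
Qed.

Lemma truncD m x y : trunc m (x + y) = trunc m x + trunc m y.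
Proof.
apply/funext => k; rewrite !fctE /trunc /=.
by case: ifP; rewrite ?addr0.
Qed.

Lemma truncZ m (a : K) x : trunc m (a *: x) = a *: trunc m x.
Proof.
apply/funext => k; rewrite !fctE /trunc /=.
by case: ifP; rewrite ?scaler0.
Qed.

Lemma eq_trunc m x y : (forall k, (k < m)%N -> x k = y k) -> trunc m x = trunc m y.
Proof. by move=> xy; apply/funext => k; rewrite /trunc; case: ifP => // /xy. Qed.

Lemma segment0E m x : segment 0 m x = trunc m.+1 x.
Proof.
rewrite /segment; elim: m.+1 => [|k IH]; first by rewrite big_geq // trunc0.
by rewrite big_nat_recr //= IH truncS.
Qed.

Lemma snorm_trunc_le m x (B : K) : (forall k, `|x k| <= B) ->
  s (trunc m x) <= m%:R * B.
Proof.
move=> xB; elim: m => [|m IH]; first by rewrite trunc0 snorm0 mul0r.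
rewrite truncS; apply: le_trans (snormD (fin_supp_trunc _ _) (fin_supp_tens _ _)) _.
by rewrite snorm_tens -natr1 mulrDl mul1r lerD.
Qed.

Definition trunc_bounded x (C : K) := forall m, s (trunc m x) <= C.

Lemma ext_norm_le x C : (ext_norm s x <= C%:E)%E <-> trunc_bounded x C.
Proof.
split=> [H|H]; last first.
  by apply: ge_ereal_sup => _ [m _ <-]; rewrite lee_fin segment0E.
have HS m : s (trunc m.+1 x) <= C.
  rewrite -lee_fin -segment0E; apply: le_trans H.
  by apply: ereal_sup_ubound; exists m.
(* [ext_norm] sees only truncations of length at least one; for the empty one, 0 <= C follows from
   nonnegativity of s. *)
case=> [|//]; rewrite trunc0 snorm0; apply: le_trans (HS 0%N).
exact/snorm_ge0/fin_supp_trunc.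
Qed.

Lemma natural_domainP x : natural_domain s x ->
  exists C, trunc_bounded x C.
Proof.
move=> [_]; case E : (ext_norm s x) => [C||] //.
  by exists C; apply/ext_norm_le; rewrite E.
by exists 0; apply/ext_norm_le; rewrite E leNye.
Qed.

Lemma domain_ballP x C : bounded_fun x -> trunc_bounded x C -> domain_ball s C x.
Proof.
move=> bx /ext_norm_le xC; split=> //; split=> //.
by apply: le_lt_trans xC _; rewrite ltry.
Qed.

(** Coordinates are replaced one at a time while w carries the others, some already replaced and
    some not; hence the quantification over all finitely supported w. *)
Lemma replace_coordinates (y : nat -> X) (T : nat -> set X) (d : nat -> K) :
  (forall j w, fin_supp w ->
    exists2 z, T j z & s (w + tens (y j) j) <= s (w + tens z j) + d j) ->
  forall m, exists2 z, (forall j, T j (z j)) &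
    s (trunc m y) <= s (trunc m z) + \sum_(j < m) d j.
Proof.
move=> H m; suff G w : fin_supp w -> exists2 z, (forall j, T j (z j)) &
    s (w + trunc m y) <= s (w + trunc m z) + \sum_(j < m) d j.
  by have [z Tz] := G 0 fin_supp0; rewrite !add0r; exists z.
elim: m w => [|m IH] w fw.
  have /choice[z Tz] : forall j, exists z, T j z.
    by move=> j; have [z Tz _] := H j 0 fin_supp0; exists z.
  by exists z => //; rewrite !trunc0 big_ord0 !addr0.
have [|z Tz le1] := IH (w + tens (y m) m).
  by apply: fin_suppD => //; exact: fin_supp_tens.
have [|t Tt le2] := H m (w + trunc m z).
  by apply: fin_suppD => //; exact: fin_supp_trunc.
exists (fun j => if j == m then t else z j); first by move=> j; case: eqP => // ->.
have E : trunc m (fun j => if j == m then t else z j) = trunc m z.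
  by apply: eq_trunc => k km; rewrite ltn_eqF.
rewrite !truncS eqxx E.
rewrite big_ord_recr /= addrA addrAC; rewrite [w + (_ + _)]addrA.
apply: le_trans le1 _; rewrite [w + tens (y m) m + _]addrAC.
by move: le2; lra.
Qed.

End BimonotoneNorm.

(** * Transfer of bounds between subsequences *)

(* Multiples of the weights w of the targets are subtracted from mu as long   *)
(* as the support of some w is contained in that of the remainder rho; each   *)
(* step kills a point of the support.                                         *)
Lemma greedy_decomposition (K : realType) (X : normedModType K) n
    (x : 'I_n -> X) (T : ('I_n -> K) -> X -> Prop) (Q : K -> X -> K) (b eta : K) :
  Q 0 0 <= 0 -> (forall c d t u, Q (c + d) (t + u) <= Q c t + Q d u) ->
  (forall a t, 0 <= a -> Q a (a *: t) <= a * Q 1 t) ->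
  (forall w z, T w z -> [/\ forall i, 0 <= w i, \sum_i w i = 1,
     `|\sum_i w i *: x i - z| <= eta & Q 1 z <= b]) ->
  forall mu : 'I_n -> K, (forall i, 0 <= mu i) ->
  exists (rho : 'I_n -> K) (t : X), [/\ forall i, 0 <= rho i <= mu i,
     forall w z, T w z -> exists2 i, w i != 0 & rho i = 0,
     Q (\sum_i mu i - \sum_i rho i) t <= (\sum_i mu i - \sum_i rho i) * b &
     `|\sum_i (mu i - rho i) *: x i - t| <= eta * (\sum_i mu i - \sum_i rho i)].
Proof.
move=> Q0 QD QZ TP mu; have [m] := ubnP #|[pred i | mu i != 0]|.
elim: m mu => // m IH mu; rewrite ltnS => mum mu0.
have [H|] := EM (forall w z, T w z -> exists2 i, w i != 0 & mu i = 0).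
  exists mu, 0; split=> //; first by move=> i; rewrite mu0 lexx.
    by rewrite subrr mul0r.
  rewrite subrr mulr0 subr0 big1 ?normr0 // => i _.
  by rewrite subrr scale0r.
move=> /existsNP[w /existsNP[z /not_implyP[Twz nw]]].
have [w0 w1 wz zb] := TP _ _ Twz.
have wmu i : w i != 0 -> mu i != 0.
  by move=> wi; apply/eqP => mui; apply: nw; exists i.
have [i0 wi0] : exists i, w i != 0.
  apply: contrapT => H; have : \sum_i w i = 0.
    by apply: big1 => i _; apply: contrapT => /eqP wi; apply: H; exists i.
  by rewrite w1 => /eqP; rewrite oner_eq0.
(* The minimal ratio is the largest multiple of w that stays below mu; equality holds at i1, which
   thereby leaves the support. *)
have [i1 wi1 i1min] := @arg_minP _ _ _ i0 (fun i => w i != 0) (fun i => mu i / w i) wi0.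
pose a := mu i1 / w i1.
have a0 : 0 <= a by rewrite divr_ge0.
have awmu i : a * w i <= mu i.
  have [->|wi] := eqVneq (w i) 0; first by rewrite mulr0.
  by rewrite -ler_pdivlMr ?lt_neqAle ?w0 ?andbT 1?eq_sym // i1min.
pose mu' i := mu i - a * w i.
have [||rho [t [rhomu rhoT Qt xt]]] := IH mu'.
- apply: leq_trans mum; apply: proper_card; apply/properP; split.
    apply/fintype.subsetP => i; rewrite !inE; apply: contra => /eqP mui.
    have wi : w i = 0 by apply: contrapT => /eqP /wmu; rewrite mui eqxx.
    by rewrite /mu' mui wi mulr0 subrr.
  exists i1; first by rewrite inE wmu.
  by rewrite inE negbK /mu' /a divfK ?subrr.
- by move=> i; rewrite /mu' subr_ge0.
have Smu : \sum_i mu i = \sum_i mu' i + a.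
  by rewrite /mu' sumrB -mulr_sumr w1 mulr1 subrK.
exists rho, (t + a *: z); split=> //.
- move=> i; have /andP[-> /= h] := rhomu i; apply: le_trans h _.
  by rewrite /mu' gerBl mulr_ge0.
- rewrite Smu addrAC; apply: le_trans (QD _ _ _ _) _.
  rewrite mulrDl lerD //; apply: le_trans (QZ _ _ a0) _.
  by rewrite ler_wpM2l.
- rewrite Smu addrAC mulrDr.
  have -> : \sum_i (mu i - rho i) *: x i =
      \sum_i (mu' i - rho i) *: x i + a *: \sum_i w i *: x i.
    rewrite scaler_sumr -big_split; apply: eq_bigr => i _.
    by rewrite /= scalerA -scalerDl /mu'; congr (_ *: _); ring.
  rewrite opprD addrACA -scalerBr.
  apply: le_trans (ler_normD _ _) _; apply: lerD => //.
  by rewrite normrZ ger0_norm // mulrC ler_wpM2r.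
Qed.

Lemma homo_ltn_ge (f : nat -> nat) : {homo f : i j / (i < j)%N} ->
  forall i, (i <= f i)%N.
Proof. by move=> fi; elim=> // i IH; exact: leq_ltn_trans IH (fi _ _ (leqnn _)). Qed.

Lemma homo_ltn_mono (f : nat -> nat) : {homo f : i j / (i < j)%N} ->
  {mono f : i j / (i < j)%N}.
Proof. by move=> fi; exact: leqW_mono (leq_mono fi). Qed.

Lemma homo_ltn_inj (f : nat -> nat) : {homo f : i j / (i < j)%N} -> injective f.
Proof.
by move=> fi i j fij; case: (ltngtP i j) => // /fi; rewrite fij ltnn.
Qed.

Lemma infinite_homo_image (f : nat -> nat) (M : set nat) :
  {homo f : i j / (i < j)%N} -> infinite_set M -> infinite_set (f @` M).
Proof.
move=> fi /infinite_natP iM; apply/infinite_natP => n.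
have [m Mm nm] := iM n; exists (f m); first by exists m.
exact: leq_trans nm (homo_ltn_ge fi m).
Qed.

Lemma diagonal_sequence (M : nat -> set nat) (t : nat -> nat) :
  (forall n, infinite_set (M n)) ->
  exists f : nat -> nat, {homo f : i j / (i < j)%N} /\
    forall n, M n (f n) /\ (t n <= f n)%N.
Proof.
move=> iM; have /choice[g gP] : forall nb : nat * nat, exists m,
    M nb.1 m /\ (nb.2 <= m)%N.
  by move=> [n b]; have /infinite_natP/(_ b)[m] := iM n; exists m.
pose f := fix f n := if n is n'.+1 then g (n, maxn (f n').+1 (t n)) else g (0%N, t 0%N).
exists f; split.
  apply: (homo_ltn ltn_trans) => n; have [_] := gP (n.+1, maxn (f n).+1 (t n.+1)).
  by rewrite /= geq_max => /andP[].
case=> [|n] /=; first exact: gP (0%N, t 0%N).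
have [? ] := gP (n.+1, maxn (f n).+1 (t n.+1)).
by rewrite /= geq_max => /andP[].
Qed.

Lemma infsub_refl M : infinite_set M -> infsub M M.
Proof. by split. Qed.

Lemma infsub_trans L M N : infsub L M -> infsub M N -> infsub L N.
Proof. by move=> [_ ML] [iN NM]; split=> //; exact: subset_trans ML. Qed.

(** Decreasing sets M n satisfying property number n are chosen, and f n in M n; then all of f([n,
    oo)) lies in M n, without exceptional points. *)
Lemma diagonal_subset (good : nat -> set nat -> Prop) (L : set nat) :
  infinite_set L ->
  (forall n M N, good n M -> infsub M N -> good n N) ->
  (forall n M, infsub L M -> exists2 N, infsub M N & good n N) ->
  exists f : nat -> nat, [/\ {homo f : i j / (i < j)%N}, forall i, L (f i) &
    forall n M, infinite_set M -> M `<=` f @` [set i | (n <= i)%N] -> good n M].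
Proof.
move=> iL hgood H.
have /choice[g gP] : forall nM : nat * set nat, exists N, infsub L nM.2 ->
    infsub nM.2 N /\ good nM.1 N.
  move=> [n M]; have [LM|nLM] := EM (infsub L M); last by exists set0.
  by have [N MN gN] := H n M LM; exists N.
pose M := fix M n := if n is n'.+1 then g (n, M n') else g (0%N, L).
have LM n : infsub L (M n).
  elim: n => [|n IH] /=; first exact: (gP (0%N, L) (infsub_refl iL)).1.
  exact: infsub_trans IH (gP (n.+1, M n) IH).1.
have gM n : good n (M n).
  case: n => [|n] /=; first exact: (gP (0%N, L) (infsub_refl iL)).2.
  exact: (gP (n.+1, M n) (LM n)).2.
have Mdec n m : (n <= m)%N -> M m `<=` M n.
  elim: m => [|m IH]; first by rewrite leqn0 => /eqP ->.
  rewrite leq_eqVlt => /predU1P[->//|nm].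
  apply: subset_trans (IH nm); exact: (gP (m.+1, M m) (LM m)).1.2.
have [f [fi fM]] := @diagonal_sequence M (fun=> 0%N) (fun n => (LM n).1).
exists f; split=> // [i|n N iN Nf]; first exact: (LM i).2 (fM i).1.
apply: (hgood n (M n)) => //; split=> // i /Nf[a /= na <-].
exact: Mdec na _ (fM a).1.
Qed.

(** The same bound n serves on both sides because i <= phi i. *)
Lemma sum_reindex (V : nmodType) (phi : nat -> nat) (f : nat -> V) n :
  {homo phi : i j / (i < j)%N} ->
  (forall l, f l != 0 -> (l < n)%N /\ range phi l) ->
  \sum_(i < n) f (phi i) = \sum_(l < n) f l.
Proof.
move=> phii fP; have inj := homo_ltn_inj phii.
rewrite (fsbig_ord _ _ f) (fsbig_ord _ _ (f \o phi)).
transitivity (\sum_(l \in phi @` `I_n) f l).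
  by apply/esym/fsbig_image => i j _ _; exact: inj.
transitivity (\sum_(l \in `I_n `&` phi @` `I_n) f l).
  apply/esym/fsbig_widen; first by move=> l [].
  move=> l /= [[i /= ni <-] nl]; apply: contrapT => /eqP /fP[ln _].
  by apply: nl; split=> //; exists i.
apply: fsbig_widen; first by move=> l [].
move=> l /= [ln nl]; apply: contrapT => /eqP /fP[_ [i _ il]].
apply: nl; split=> //; exists i => //=; apply: leq_ltn_trans ln.
by rewrite -il; exact: homo_ltn_ge.
Qed.

Section Transfer.
Variables (K : realType) (P : set nat -> nat -> probability nat K).
Variable F : set (set nat).
Hypothesis blockP : probability_block P F.
Variables (X : completeNormedModType K) (s : (nat -> X) -> K).
Hypothesis bimon_s : bimonotone_norm s.

(** E is continued by points of L beyond it. The first block of the resulting set is comparable with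
    E; if it contains E, heredity puts E in F. *)
Lemma member_or_block (L E : set nat) : infinite_set L -> finite_set E ->
  E `<=` L -> F E \/ exists2 N, infsub L N & initseg E N /\ supp (P N 0%N) `<=` E.
Proof.
move=> iL /finite_nat_bound[n En] EL; pose N := E `|` (L `&` [set i | (n < i)%N]).
have iN : infinite_set N.
  by apply: (sub_infinite_set _ (infinite_above (n := n) iL)) => i; right.
have EN : initseg E N.
  split=> [i|i j [//|[_ /= ni]] Ej ij]; first by left.
  by have := leq_ltn_trans ij (En _ Ej); rewrite ltnNge (ltnW ni).
have [ES|SE] := initseg_total EN (supp0_initseg blockP iN).
  by left; exact: (block_hereditary blockP) (supp_member blockP 0 iN) ES.
right; exists N; last by split.
by split=> // i [/EL//|[]].
Qed.

(** By contradiction: if every candidate z satisfies s(w + z e_j) <= b, with b lying 7 eps B below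
    the value at the mu-average, then by convexity so does every convex combination of candidates up
    to the approximation errors. The greedy decomposition brings the mu-average within 6 eps B of a
    point where the value is at most b. *)
Lemma block_replacement (x : nat -> X) (B eps : K) (L : set nat) (mu : nat -> K)
    (n k : nat) :
  0 < B -> (forall i, `|x i| <= B) -> 0 < eps -> eps < 2^-1 ->
  infinite_set L ->
  (forall i, 0 <= mu i) ->
  (forall i, mu i != 0 -> [/\ (i < n)%N, (k <= i)%N & L i]) ->
  mu k != 0 -> \sum_(i < n) mu i = 1 -> mu k <= eps ->
  (forall A, A `<=` [set i | mu i != 0 /\ (k < i)%N] -> F ([set k] `|` A) ->
     \sum_(i < n | `[< A i >]) mu i <= eps) ->
  (forall N, infsub L N -> (forall i, N i -> (k <= i)%N) ->
     weight (P N 0%N) k <= eps) ->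
  forall j w, fin_supp w ->
  exists2 N, infsub L N /\ supp (P N 0%N) `<=` [set i | mu i != 0] &
    s (w + tens (\sum_(i < n) mu i *: x i) j) <=
    s (w + tens (average (P N 0%N) x) j) + 7 * eps * B.
Proof.
move=> B0 xB eps0 eps2 iL mu0 muL muk mu1 muke muA Nk j w fw.
apply: contrapT => none.
set y := \sum_(i < n) mu i *: x i in none.
pose b := s (w + tens y j) - 7 * eps * B.
have kn : (k < n)%N by have [] := muL k muk.
(* Dropping k, whose weight is at most eps, and renormalizing costs 2 eps B. *)
pose T (v : 'I_n -> K) z := exists N, [/\ infsub L N,
  supp (P N 0%N) `<=` [set i | mu i != 0], supp (P N 0%N) k,
  forall i : 'I_n, v i = if i == k :> nat then 0
    else weight (P N 0%N) i / (1 - weight (P N 0%N) k) & z = average (P N 0%N) x].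
(* Scaling w along with t turns convexity into sublinearity in the pair, which applies to
   combinations of any total coefficient. *)
pose Q (c : K) (t : X) := s (c *: w + tens t j).
have fQ c t : fin_supp (c *: w + tens t j).
  by apply: fin_suppD; [exact: fin_suppZ | exact: fin_supp_tens].
have tensD t u : tens (t + u) j = tens t j + tens u j :> (nat -> X).
  by apply/funext => i; rewrite !fctE /tens; case: ifP; rewrite ?addr0.
have tensZ a t : tens (a *: t) j = a *: tens t j :> (nat -> X).
  by apply/funext => i; rewrite !fctE /tens; case: ifP; rewrite ?scaler0.
have QD c d t u : Q (c + d) (t + u) <= Q c t + Q d u.
  rewrite /Q tensD scalerDl addrACA; exact: (snormD bimon_s).
have QZ a c t : 0 <= a -> Q (a * c) (a *: t) <= a * Q c t.
  move=> a0; rewrite /Q tensZ -scalerA -scalerDr (snormZ bimon_s) //.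
  by rewrite ger0_norm.
have TP v z : T v z -> [/\ forall i, 0 <= v i, \sum_i v i = 1,
    `|\sum_i v i *: x i - z| <= 2 * eps * B & Q 1 z <= b].
  move=> [N [[iN NL] Nmu kN vE ->]].
  have Nk' i : N i -> (k <= i)%N.
    move=> Ni; rewrite leqNgt; apply/negP => ik.
    have [_ /(_ i k Ni kN (ltnW ik)) /Nmu /muL[_ ki _]] := supp0_initseg blockP iN.
    by move: ik; rewrite ltnNge ki.
  have := Nk N (conj iN NL) Nk'; set a := weight _ k in vE * => ae.
  have a0 : 0 <= a by exact: weight_ge0.
  have a1 : 0 < 1 - a by move: eps2 ae; lra.
  have Nn : supp (P N 0%N) `<=` [set i | (i < n)%N] by move=> i /Nmu /muL[].
  pose ok := Ordinal kn.
  have wS : \sum_(i < n | i != ok) weight (P N 0%N) i = 1 - a.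
    by have := sum_weight_supp Nn; rewrite (bigD1 ok) //= -/a => <-; rewrite [RHS]addrC addKr.
  pose S : X := \sum_(i < n | i != ok) weight (P N 0%N) i *: x i.
  have Sle : `|S| <= (1 - a) * B.
    rewrite -wS mulr_suml; apply: le_trans (ler_norm_sum _ _ _) _.
    apply: ler_sum => i _; rewrite normrZ ger0_norm ?weight_ge0 //.
    by rewrite ler_wpM2l // weight_ge0.
  have vok : v ok = 0 by rewrite vE eqxx.
  have vN (i : 'I_n) : i != ok -> v i = weight (P N 0%N) i / (1 - a).
    by rewrite vE => iok; rewrite ifN.
  split.
  - by move=> i; rewrite vE; case: ifP => // _; rewrite divr_ge0 ?weight_ge0 // ltW.
  - rewrite (bigD1 ok) //= vok add0r (eq_bigr _ vN) -mulr_suml wS divff //.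
    by rewrite gt_eqF.
  - rewrite (averageE _ Nn) (bigD1 ok) //= vok scale0r add0r.
    rewrite [X in _ - X](bigD1 ok) //= -/S -/a.
    have -> : \sum_(i < n | i != ok) v i *: x i = (1 - a)^-1 *: S.
      rewrite scaler_sumr; apply: eq_bigr => i /vN ->.
      by rewrite scalerA mulrC.
    have -> : (1 - a)^-1 *: S - (a *: x k + S) = (a / (1 - a)) *: S - a *: x k.
      rewrite opprD addrCA addrC; congr (_ + _).
      rewrite -[X in _ - X]scale1r -scalerBl; congr (_ *: _).
      by field; rewrite gt_eqF.
    apply: le_trans (ler_normB _ _) _; rewrite !normrZ.
    rewrite !ger0_norm ?divr_ge0 ?invr_ge0 // ?(ltW a1) //.
    have h1 : a / (1 - a) * `|S| <= a * B.
      rewrite mulrAC -mulrA; apply: ler_wpM2l => //.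
      by rewrite ler_pdivrMr // mulrC.
    have h2 : a * `|x k| <= a * B by exact: ler_wpM2l.
    have h3 : a * B <= eps * B by rewrite ler_wpM2r // ltW.
    by move: h1 h2 h3; lra.
  - rewrite /Q scale1r /b lerBrDr leNgt; apply/negP => H; apply: none.
    by exists N => //; exact: ltW.
(* Every target block contains k, whose mass is small, so the subtraction would stop as soon as k is
   used up. Hence k is taken out of mu as well as of the targets. *)
pose mu' (i : 'I_n) := if i == k :> nat then 0 else mu i.
have Q0 : Q 0 0 <= 0 by have := QZ 0 0 0 (lexx 0); rewrite !mul0r scaler0.
pose ok := Ordinal kn.
have [||rho [t [rhomu rhoT Qt xt]]] := greedy_decomposition Q0 QD _ TP (mu := mu').
- by move=> a u a0; have := QZ a 1 u a0; rewrite mulr1.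
- by move=> i; rewrite /mu'; case: ifP.
have mu'E (i : 'I_n) : i != ok -> mu' i = mu i by move=> iok; rewrite /mu' ifN.
have mu'k : mu' ok = 0 by rewrite /mu' eqxx.
have Smu' : \sum_i mu' i = 1 - mu k.
  rewrite (bigD1 ok) //= mu'k add0r (eq_bigr _ mu'E) -mu1 [in RHS](bigD1 ok) //=.
  by rewrite [RHS]addrC addKr.
(* Unless {k} U A belongs to F, it contains a first block, which must pass through k because k is
   minimal; the second hypothesis excludes this. *)
have small (A : set nat) : A `<=` [set i | mu i != 0 /\ (k < i)%N] ->
    (forall N, infsub L N -> supp (P N 0%N) k ->
       supp (P N 0%N) `<=` [set i | mu i != 0] ->
       exists i, [/\ supp (P N 0%N) i, i <> k & ~ A i]) ->
    \sum_(i < n | `[< A i >]) mu i <= eps.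
  move=> Amu H; apply: muA => //.
  have kAn i : ([set k] `|` A) i -> [/\ (i < n)%N, (k <= i)%N & L i].
    by move=> [->|/Amu[/muL//]]; exact: muL.
  have [||//|[N NL [EN Nsub]]] := member_or_block (E := [set k] `|` A) iL.
  - by apply: (sub_finite_set _ (finite_II n)) => i /kAn[].
  - by move=> i /kAn[].
  exfalso; have [a Na] := supp_nonempty blockP 0 NL.1.
  have [_ /(_ k a)] := supp0_initseg blockP NL.1 => Nk0.
  have Nk1 : supp (P N 0%N) k.
    by apply: Nk0 => //; [apply: EN.1; left | have [] := kAn _ (Nsub _ Na)].
  have [i [Ni ik nA]] := H N NL Nk1 (fun i Ni => match Nsub i Ni with
    or_introl e => eq_ind_r (fun i => mu i != 0) muk e | or_intror Ai => (Amu i Ai).1 end).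
  by case: (Nsub i Ni).
have rho_small : \sum_i rho i <= eps.
  pose A := [set i | exists h : (i < n)%N, rho (Ordinal h) != 0].
  have Amu i : A i -> mu i != 0 /\ (k < i)%N.
    move=> [h rhoi]; have /andP[r0 rmu] := rhomu (Ordinal h).
    have mi : mu' (Ordinal h) != 0.
      by apply: contraNneq rhoi => m0; rewrite eq_le r0 andbT -m0.
    move: mi; rewrite /mu' /=; case: (eqVneq i k) => [_|ik]; first by rewrite eqxx.
    by move=> mi; have [_ ki _] := muL i mi; split=> //; rewrite ltn_neqAle eq_sym ik.
  apply: le_trans (small A Amu _); last first.
    move=> N NL Nk1 Nmu; pose v (i : 'I_n) := if i == k :> nat then 0
      else weight (P N 0%N) i / (1 - weight (P N 0%N) k).
    have [|i vi rhoi] := rhoT v (average (P N 0%N) x); first by exists N.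
    move: vi; rewrite /v; case: (eqVneq (i : nat) k) => [_|ik vi]; first by rewrite eqxx.
    exists i; split; last 1 first.
    - move=> [h]; rewrite (_ : Ordinal h = i) ?rhoi ?eqxx //; exact: val_inj.
    - by apply/suppE; apply: contraNneq vi => ->; rewrite mul0r.
    - exact/eqP.
  rewrite [leRHS]big_mkcond; apply: ler_sum => i _; case: asboolP => [Ai|nA].
    have /andP[_ h] := rhomu i; apply: le_trans h _; rewrite /mu'.
    by case: ifP.
  rewrite leNgt; apply/negP => r0; apply: nA; exists (ltn_ord i).
  by rewrite (_ : Ordinal _ = i) ?gt_eqF //; exact: val_inj.
(* Without a target the whole support of mu beyond k would have mass at most eps, against eps < 1/2.
   The target z0 will fill up the total coefficient from c to 1. *)
have [v0 [z0 Tz0]] : exists v z, T v z.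
  apply: contrapT => nT.
  have := small [set i | mu i != 0 /\ (k < i)%N] (fun _ h => h).
  have -> : \sum_(i < n | `[< mu i != 0 /\ (k < i)%N >]) mu i = \sum_i mu' i.
    rewrite big_mkcond; apply: eq_bigr => i _; rewrite /mu'.
    case: (eqVneq (i : nat) k) => [->|ik].
      by case: asboolP => // -[_]; rewrite ltnn.
    case: asboolP => // H; apply/esym/eqP; rewrite -[_ == _]negbK.
    apply/negP => mi; apply: H; split=> //; have [_ ki _] := muL i mi.
    by rewrite ltn_neqAle eq_sym ik.
  rewrite Smu' => H; have : 1 - mu k <= eps.
    apply: H => N NL Nk1 Nmu; exfalso; apply: nT.
    exists (fun i : 'I_n => if i == k :> nat then 0
      else weight (P N 0%N) i / (1 - weight (P N 0%N) k)), (average (P N 0%N) x).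
    by exists N.
  by move: muke eps2; lra.
set c := \sum_i mu' i - \sum_i rho i in Qt xt.
have rho0 : 0 <= \sum_i rho i by apply: sumr_ge0 => i _; have /andP[] := rhomu i.
have c1 : 0 <= 1 - c by rewrite /c Smu'; move: (mu0 k) rho0; lra.
have c2 : 1 - c <= 2 * eps by rewrite /c Smu'; move: muke rho_small; lra.
have [_ _ _ Qz0] := TP _ _ Tz0.
have le1 : s (w + tens (t + (1 - c) *: z0) j) <= b.
  rewrite -[w in X in s X]scale1r -[X in X *: w](subrKC c).
  apply: le_trans (QD _ _ _ _) _; have := QZ _ 1 z0 c1; rewrite mulr1.
  have : (1 - c) * Q 1 z0 <= (1 - c) * b by exact: ler_wpM2l.
  by move: Qt; lra.
have z0B : `|z0| <= B.
  have [N [[iN _] _ _ _ ->]] := Tz0.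
  by apply: average_le => //; exact: (supp_finite blockP).
(* The errors are 2 eps B from the greedy approximation, eps B from rho, eps B from the point k, and
   2 eps B from filling up with z0. *)
have le2 : `|y - (t + (1 - c) *: z0)| <= 6 * eps * B.
  have -> : y - (t + (1 - c) *: z0) = (\sum_i (mu' i - rho i) *: x i - t) +
      (\sum_(i < n) rho i *: x i + (mu k *: x k - (1 - c) *: z0)).
    have -> : y = \sum_(i < n) (mu' i - rho i) *: x i +
        (\sum_(i < n) rho i *: x i + mu k *: x k).
      rewrite addrA -big_split /= (eq_bigr (fun i : 'I_n => mu' i *: x i)); last first.
        by move=> i _; rewrite -scalerDl subrK.
      rewrite [X in _ = X + _](bigD1 ok) //= mu'k scale0r add0r.
      rewrite /y (bigD1 ok) //= addrC; congr (_ + _).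
      by apply: eq_bigr => i /mu'E ->.
    by rewrite opprD addrACA -!addrA.
  have h1 : `|\sum_(i < n) rho i *: x i| <= eps * B.
    apply: le_trans (ler_norm_sum _ _ _) _.
    apply: (@le_trans _ _ ((\sum_i rho i) * B)); last by rewrite ler_wpM2r // ltW.
    rewrite mulr_suml; apply: ler_sum => i _; have /andP[r0 _] := rhomu i.
    by rewrite normrZ ger0_norm // ler_wpM2l.
  have h2 : `|mu k *: x k| <= eps * B.
    by rewrite normrZ ger0_norm //; apply: ler_pM.
  have h3 : `|(1 - c) *: z0| <= 2 * eps * B.
    by rewrite normrZ ger0_norm //; apply: ler_pM.
  have h4 : 2 * eps * B * c <= 2 * eps * B.
    rewrite ler_piMr //; last by move: c1; lra.
    by rewrite !mulr_ge0 // ltW.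
  apply: le_trans (ler_normD _ _) _.
  have := ler_normD (\sum_(i < n) rho i *: x i) (mu k *: x k - (1 - c) *: z0).
  have := ler_normB (mu k *: x k) ((1 - c) *: z0).
  by move: xt h1 h2 h3 h4; lra.
have : s (w + tens y j) <= b + 6 * eps * B.
  rewrite -[y in tens y j](subrKC (t + (1 - c) *: z0)) tensD addrA.
  apply: le_trans (snormD bimon_s _ _) _.
    by apply: fin_suppD => //; exact: fin_supp_tens.
    exact: fin_supp_tens.
  by rewrite (snorm_tens bimon_s) lerD.
rewrite /b; have : 0 < eps * B by rewrite mulr_gt0.
by lra.
Qed.

Lemma average_supp1 (p : probability nat K) (x : nat -> X) a :
  supp p = [set a] -> average p x = x a.
Proof.
move=> pa; have sn : supp p `<=` [set i | (i < a.+1)%N] by rewrite pa => i -> /=.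
have w0 i : i != a -> weight p i = 0.
  move=> ia; apply: contrapT => /eqP /suppE; rewrite pa => ia'.
  by rewrite ia' eqxx in ia.
have ai (i : 'I_a) : (i : nat) != a by rewrite ltn_eqF.
have := sum_weight_supp sn; rewrite big_ord_recr /= big1 ?add0r => [wa|i _]; last first.
  by rewrite w0.
rewrite (averageE _ sn) big_ord_recr /= wa scale1r big1 ?add0r // => i _.
by rewrite w0 // scale0r.
Qed.

Variable xi : ord.
Hypothesis homP : homogeneous xi P F.

(** Both halves of homogeneity enter here: the rank of F bounds the rank of the link, and
    sufficiency then makes the link small. *)
Lemma small_on_link n L (eps : K) : infinite_set L -> 0 < eps ->
  exists2 M, infsub L M &
    forall N, infsub M N -> forall H, link F n H -> fine (P N 0%N H) <= eps.
Proof.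
move=> iL eps0; have [Fr _ _] := block_nice blockP; have [suff [F0 _]] := homP.
have [a ra axi] := rank_link n (block_hereditary blockP) F0.
have [M LM Msup] := suff _ _ (regular_link n Fr) ra axi L eps iL eps0.
exists M => // N MN H FH; rewrite -lee_fin fineK ?prob_fin_num //.
by apply: le_trans Msup; apply: ereal_sup_ubound; exists N => //; exists H.
Qed.

(** The inclusion of supports keeps the replacing blocks successive, so that [concat_blocks] can
    glue these first blocks into one subset of L. *)
Definition replaceable (phi : nat -> nat) (L : set nat) (x : nat -> X) (d : nat -> K) :=
  forall N, infsub (phi @` L) N -> forall j w, fin_supp w ->
  exists2 N', infsub L N' /\ phi @` supp (P N' 0%N) `<=` supp (P N j) &
    s (w + tens (average (P N j) x) j) <=
    s (w + tens (average (P N' 0%N) (x \o phi)) j) + d j.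

Lemma replaceable_bound phi L x d (B C : K) : {homo phi : i j / (i < j)%N} ->
  replaceable phi L x d -> (forall m, \sum_(j < m) d j <= B) ->
  (forall N, infsub L N -> trunc_bounded s (block_average P N (x \o phi)) C) ->
  forall N, infsub (phi @` L) N -> trunc_bounded s (block_average P N x) (C + B).
Proof.
move=> phii R dB LC N LN m.
pose T j (z : X) := exists N', [/\ infsub L N',
  phi @` supp (P N' 0%N) `<=` supp (P N j) & z = average (P N' 0%N) (x \o phi)].
have [|z Tz zle] := @replace_coordinates _ _ s (block_average P N x) T d _ m.
  move=> j w fw; have [N' [LN' N'N] le] := R N LN j w fw.
  by exists (average (P N' 0%N) (x \o phi)) => //; exists N'.
have /choice[M MP] := Tz.
have [||iU PU] := concat_blocks blockP (M := M).
- by move=> j; have [[]] := MP j.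
- move=> j a b Ma Mb; have [_ Mj _] := MP j; have [_ Mj1 _] := MP j.+1.
  rewrite -(homo_ltn_mono phii).
  apply: (@block_successive _ _ _ blockP N j LN.1); first by apply: Mj; exists a.
  by apply: Mj1; exists b.
apply: le_trans zle _; apply: lerD => //.
have U : infsub L (\bigcup_j supp (P (M j) 0%N)).
  split=> // i [j _ Mi]; have [[iM MjL] _ _] := MP j.
  by apply: MjL; exact: (supp_sub blockP) Mi.
have -> : trunc m z = trunc m (block_average P (\bigcup_j supp (P (M j) 0%N)) (x \o phi)).
  apply: eq_trunc => k _; have [_ _ ->] := MP k.
  by apply/esym; exact: average_eq (PU k).
exact: LC.
Qed.

(** The degenerate case: each block is a single point of mass 1, so no smallness is available, but
    averaging is passing to a subsequence and the replacement is exact. *)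
Lemma replaceable_singletons phi L x : {homo phi : i j / (i < j)%N} ->
  (forall n, MAX F [set n]) -> infinite_set L ->
  replaceable phi L x (fun=> 0).
Proof.
move=> phii F1 iL N [iN NL] j w fw.
have single E : MAX F E -> exists a, E = [set a].
  move=> mE; have [a Ea am] := nat_least (max_nonempty blockP mE).
  exists a; apply: (F1 a).2; first exact: mE.1.
  split=> [i -> //|i k Ei -> ik]; apply/eqP; rewrite eqn_leq ik.
  exact: am.
have [e Ee] := single _ (block_max blockP j iN).
have [k Lk ke] : (phi @` L) e.
  by apply: NL; apply: (@supp_sub _ _ _ blockP N j iN); rewrite Ee.
pose N' := L `&` [set i | (k <= i)%N].
have iN' : infinite_set N'.
  by apply: (sub_infinite_set _ (infinite_above (n := k) iL)) => i [Li /= /ltnW].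
have [a Ea] := single _ (block_max blockP 0 iN').
have ak : a = k.
  have [sub init] := supp0_initseg blockP iN'.
  have [_ ka] : N' a by apply: sub; rewrite Ea.
  suff : supp (P N' 0%N) k by rewrite Ea.
  by apply: init ka; [split=> //=| rewrite Ea].
exists N'; first by split; [split=> // i [] | rewrite Ea Ee ak => i [? -> <-]].
by rewrite (average_supp1 _ Ee) (average_supp1 _ Ea) /= ak ke addr0.
Qed.

(** Along the diagonal sequence phi, first measures of subsets of phi([n, oo)) give mass at most eps
    n to members of [link F n]. If block j of N has least element phi k, then j <= k, and the tail
    of N starting with this block is such a subset for n = k. This supplies the smallness that
    [block_replacement] requires. *)
Lemma replaceable_blocks (L : set nat) n0 : ~ MAX F [set n0] -> infinite_set L ->
  exists phi : nat -> nat, [/\ {homo phi : i j / (i < j)%N}, forall i, L (phi i) &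
    forall x (B : K), 0 < B -> (forall i, `|x i| <= B) ->
    forall L0, infinite_set L0 -> exists2 L', infsub L0 L' &
      replaceable phi L' x (fun j => B / 2 / 2 ^+ j)].
Proof.
(* With 14 the error 7 eps_j B equals B / 2 / 2^j, and these sum to at most B. *)
move=> nmax iL; pose eps j : K := 14^-1 / 2 ^+ j.
have eps0 j : 0 < eps j by rewrite /eps divr_gt0 ?invr_gt0 ?exprn_gt0 // ltr0n.
have epsS i j : (i <= j)%N -> eps j <= eps i.
  move=> ij; rewrite /eps ler_pM2l ?invr_gt0 ?ltr0n // lef_pV2 ?posrE ?exprn_gt0 //.
  by rewrite ler_weXn2l // ler1n.
have eps2 j : eps j < 2^-1.
  apply: le_lt_trans (epsS 0%N j (leq0n j)) _; rewrite /eps expr0; lra.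
pose good n M := forall N, infsub M N -> forall H, link F n H ->
  fine (P N 0%N H) <= eps n.
have [||phi [phii phiL phigood]] := @diagonal_subset good _ (infinite_above (n := 0%N) iL).
- by move=> n M N gM MN N' NN'; apply: gM; exact: infsub_trans NN'.
- by move=> n M [iM _]; have [N MN HN] := small_on_link n iM (eps0 n); exists N.
(* strictness puts {phi k} in link F k *)
have phi_gt i : (i < phi i)%N.
  elim: i => [|i IH]; first by have [] := phiL 0%N.
  exact: leq_ltn_trans IH (phii _ _ (ltnSn i)).
exists phi; split=> // [i|x B B0 xB L0 iL0]; first by have [] := phiL i.
(* Points beyond n0 form singletons in the link of n0, so sufficiency also controls individual
   weights. *)
pose good' n M := forall N, infsub M N -> forall i, (n0 < i)%N ->
  weight (P N 0%N) i <= eps n.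
(* As {n0} is not maximal, niceness puts {n0, n0 + 1} in F, and spreading gives the other pairs. *)
have pairF n k : (n0 <= n)%N -> (n < k)%N -> F ([set n] `|` [set k]).
  have [[_ sF _ _] F1 next] := block_nice blockP => n0n nk.
  have setE a b : [set a] `|` [set b] = [set` [:: a; b]].
    apply/seteqP; split=> [i [->|->]|i] /=; rewrite !inE ?eqxx ?orbT //.
    by move=> /orP[/eqP|/eqP] ->; [left | right].
  rewrite setE; apply: (sF [:: n0; n0.+1]); rewrite /= ?ltnSn ?nk //.
    by rewrite n0n (leq_ltn_trans n0n nk).
  rewrite -setE; have [//|] := next _ (F1 n0); apply.
  by move=> _ _ -> ->.
have [||g [gi gL ggood]] := @diagonal_subset good' _ (infinite_above (n := n0) iL0).
- by move=> n M N gM MN N' NN'; apply: gM; exact: infsub_trans NN'.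
- move=> n M [iM _]; have [N MN HN] := small_on_link n0 iM (eps0 n).
  exists N => // N' NN' i n0i; apply: HN => //; split; first by move=> _ _ -> ->.
  exact: pairF.
exists (range g).
  split; last by move=> _ [i _ <-]; have [] := gL i.
  by rewrite -[range g]/(g @` setT); apply: infinite_homo_image => //; exact: infinite_nat.
move=> N [iN Nphi] j w fw.
have [iT TN PT] := tail_block blockP j iN; set Tl := tail_union _ j in iT TN PT.
have [n En] := finite_nat_bound (supp_finite blockP j iN).
have [e Ee emin] := nat_least (supp_nonempty blockP j iN).
have Nrange a : N a -> exists2 i, range g i & phi i = a by move=> /Nphi[i gi' <-]; exists i.
have [k [i0 _ kE] ek] := Nrange e (supp_sub blockP iN Ee).
have ji0 : (j <= i0)%N.
  apply: (@block_index_le _ _ _ blockP (phi \o g) N) => //; last by rewrite /= kE ek.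
    by move=> a b /gi /phii.
  by move=> a /Nrange[_ [b _ <-] <-]; exists b.
have jk : (j <= k)%N by apply: leq_trans ji0 _; rewrite -kE; exact: homo_ltn_ge.
have n0k : (n0 < k)%N by rewrite -kE; have [] := gL i0.
have suppTl : supp (P Tl 0%N) = supp (P N j) by exact: supp_eq.
(* The least element of the tail is phi k, so the tail lies in phi([k, oo)). *)
have goodT : good k Tl.
  apply: phigood => // a [i /= ji Na].
  have [b gb ba] := Nrange a (supp_sub blockP iN Na).
  exists b => //=; rewrite leqNgt; apply/negP => /phii; rewrite ba ek ltnNge => /negP; apply.
  move: ji; rewrite leq_eqVlt => /predU1P[ji|ji]; first by apply: emin; rewrite ji.
  by apply: ltnW; exact: (supp_lt blockP iN ji Ee Na).
have small H : link F k H -> fine (P N j H) <= eps j.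
  move=> FH; rewrite -PT; apply: le_trans (epsS j k jk); apply: goodT => //.
  exact: infsub_refl.
pose mu i := weight (P N j) (phi i).
have reindex (V : nmodType) (f : nat -> V) :
    (forall l, ~ supp (P N j) l -> f l = 0) ->
    \sum_(i < n) f (phi i) = \sum_(l < n) f l.
  move=> f0; apply: (@sum_reindex _ phi f n phii) => l fl.
  have Nl : supp (P N j) l by apply: contrapT => /f0 fl0; rewrite fl0 eqxx in fl.
  split; first exact: En.
  by have [i _ <-] := Nrange l (supp_sub blockP iN Nl); exists i.
have w0 l : ~ supp (P N j) l -> weight (P N j) l = 0.
  by move=> nl; apply: contrapT => /eqP/suppE.
have [N' [LN' Nmu] le] : exists2 N', infsub (range g) N' /\
    supp (P N' 0%N) `<=` [set i | mu i != 0] &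
    s (w + tens (\sum_(i < n) mu i *: (x \o phi) i) j) <=
    s (w + tens (average (P N' 0%N) (x \o phi)) j) + 7 * eps j * B.
  apply: (@block_replacement (x \o phi) B (eps j) (range g) mu n k
    _ _ _ _ _ _ _ _ _ _ _ _ j w fw).
  - exact: B0.
  - by move=> i; exact: xB.
  - exact: eps0.
  - exact: eps2.
  - by rewrite -[range g]/(g @` setT); apply: infinite_homo_image => //; exact: infinite_nat.
  - by move=> i; exact: weight_ge0.
  - move=> i /suppE Ni; split.
    + exact: leq_ltn_trans (homo_ltn_ge phii i) (En _ Ni).
    + by rewrite -(leq_mono phii) ek; exact: emin.
    + have [b gb /(homo_ltn_inj phii) <-] := Nrange _ (supp_sub blockP iN Ni).
      exact: gb.
  - by apply/suppE; rewrite ek.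
  - by rewrite (reindex _ (weight (P N j)) w0); exact: sum_weight_supp.
  - apply: small; split; first by move=> _ _ -> ->; exact: phi_gt.
    by apply: pairF => //; exact: ltnW.
  (* psi fixes k and coincides with phi on A. Being increasing and above the identity, it carries
     {k} U A to {k} U phi(A) within F by spreading. *)
  - move=> A Amu FA; pose psi i := if (i <= k)%N then i else phi i.
    have psii : {homo psi : a b / (a < b)%N}.
      move=> a b ab; rewrite /psi; case: (leqP a k) => ak; case: (leqP b k) => bk //.
      + exact: leq_trans ab (homo_ltn_ge phii b).
      + by have := leq_ltn_trans bk (ltn_trans ak ab); rewrite ltnn.
      + exact: phii.
    have psi_ge a : (a <= psi a)%N by rewrite /psi; case: ifP => // _; exact: homo_ltn_ge.
    have FphiA : link F k (phi @` A).
      split.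
        move=> _ _ -> [a Aa <-]; have [_ ka] := Amu a Aa.
        exact: leq_trans ka (homo_ltn_ge phii a).
      rewrite (_ : _ `|` _ = psi @` ([set k] `|` A)).
        have [[fF sF _ _] _ _] := block_nice blockP; exact: spreading_image.
      have psiA a : A a -> psi a = phi a.
        by move=> /Amu[_ ka]; rewrite /psi leqNgt ka.
      have psik : psi k = k by rewrite /psi leqnn.
      apply/seteqP; split=> [a [->|[b Ab <-]]|_ [b [->|Ab] <-]].
      + by exists k => //; left.
      + by exists b; [right | exact: psiA].
      + by left.
      + by right; exists b => //; rewrite psiA.
    apply: le_trans (small _ FphiA).
    have AN : phi @` A `<=` supp (P N j).
      by move=> _ [a Aa <-]; have [ma _] := Amu a Aa; apply/suppE.
    rewrite -(@sum_weight _ (P N j) (phi @` A) n); last by move=> l /AN /En.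
    rewrite big_mkcond [leRHS]big_mkcond /=.
    rewrite -(reindex _ (fun l => if `[< (phi @` A) l >] then weight (P N j) l else 0)).
      apply: ler_sum => i _; case: asboolP => [Ai|_].
        by case: asboolP => // -[]; exists i.
      by case: ifP => // _; exact: weight_ge0.
    by move=> l nl; case: asboolP => // /AN.
  - move=> N' LN' kN'; apply: le_trans (epsS _ _ ji0).
    apply: (ggood i0 N' LN'.1 _ N') => //; last exact: infsub_refl LN'.1.
    move=> i N'i; have [a _ ai] := LN'.2 i N'i.
    by exists a => //=; rewrite -(leq_mono gi) ai kE; exact: kN'.
exists N'.
  by split=> // _ [i N'i <-]; apply/suppE; exact: Nmu.
rewrite (averageE _ En) -(reindex _ (fun l => weight (P N j) l *: x l)); last first.
  by move=> l /w0 ->; rewrite scale0r.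
apply: le_trans le _; rewrite lerD2l /eps le_eqVlt; apply/orP; left; apply/eqP.
by field; rewrite expf_neq0.
Qed.

(** phi is fixed before x and L0, so L0 may come from a hypothesis applied to x o phi. The proof
    splits according to whether all blocks are single points. *)
Lemma transfer L : infinite_set L ->
  exists phi : nat -> nat, [/\ {homo phi : i j / (i < j)%N}, forall i, L (phi i) &
    forall x (B C : K) L0, 0 < B -> (forall i, `|x i| <= B) -> infinite_set L0 ->
    (forall N, infsub L0 N -> trunc_bounded s (block_average P N (x \o phi)) C) ->
    exists2 M, infsub L M &
      forall N, infsub M N -> trunc_bounded s (block_average P N x) (C + B)].
Proof.
move=> iL.
have sub (phi : nat -> nat) L' : {homo phi : i j / (i < j)%N} ->
    (forall i, L (phi i)) -> infinite_set L' -> infsub L (phi @` L').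
  move=> phii phiL iL'; split; first exact: infinite_homo_image.
  by move=> _ [i _ <-].
have [F1|/existsNP[n0 nmax]] := EM (forall n, MAX F [set n]).
  have [phi [phii phiL]] := @diagonal_sequence (fun=> L) (fun=> 0%N) (fun=> iL).
  have phiL' i : L (phi i) := (phiL i).1.
  exists phi; split=> // x B C L0 B0 xB iL0 HL0.
  exists (phi @` L0); first exact: sub.
  apply: (replaceable_bound phii (@replaceable_singletons phi L0 x phii F1 iL0)) => // m.
  by rewrite big1 // ltW.
have [phi [phii phiL phiP]] := replaceable_blocks nmax iL.
exists phi; split=> // x B C L0 B0 xB iL0 HL0.
have [L' L0L' rep] := phiP x B B0 xB L0 iL0.
exists (phi @` L'); first exact: sub L0L'.1.
apply: (replaceable_bound phii rep) => [m|N L'N]; last first.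
  by apply: HL0; exact: infsub_trans L'N.
have -> : \sum_(j < m) B / 2 / 2 ^+ j = B - B / 2 ^+ m.
  elim: m => [|m IH]; first by rewrite big_ord0 expr0 divr1 subrr.
  rewrite big_ord_recr /= IH exprS; field.
  by rewrite expf_neq0.
by rewrite gerBl divr_ge0 ?exprn_ge0 // ltW.
Qed.

(** * Gliding hump and diagonal sets *)

Lemma snorm_trunc_close (y z : nat -> X) p m (D : K) :
  (forall j, `|y j - z j| <= D) -> (forall j, (p <= j)%N -> y j = z j) ->
  s (trunc m y) <= s (trunc m z) + p%:R * D.
Proof.
move=> yzD yz; have D0 : 0 <= D by apply: le_trans (yzD 0%N).
rewrite -[y](subrKC z) truncD.
apply: le_trans (snormD bimon_s _ _) _; try exact: fin_supp_trunc.
rewrite lerD2l; have -> : trunc m (y - z) = trunc (minn m p) (y - z).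
  apply/funext => k; rewrite /trunc leq_min; case: (ltnP k m) => //= km.
  by case: ltnP => // pk; rewrite !fctE yz // subrr.
apply: le_trans (snorm_trunc_le bimon_s _ yzD) _.
by rewrite ler_wpM2r // ler_nat geq_minr.
Qed.

Lemma block_average_le (x : nat -> X) (B : K) N : infinite_set N -> (forall i, `|x i| <= B) ->
  forall j, `|block_average P N x j| <= B.
Proof. by move=> iN xB j; apply: average_le => //; exact: (supp_finite blockP). Qed.

Lemma block_average_close (x : nat -> X) (B : K) N N' : infinite_set N -> infinite_set N' ->
  (forall i, `|x i| <= B) ->
  forall j, `|block_average P N x j - block_average P N' x j| <= 2 * B.
Proof.
move=> iN iN' xB j; apply: le_trans (ler_normB _ _) _.
have := block_average_le iN xB j; have := block_average_le iN' xB j.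
by lra.
Qed.

(** Gliding hump. If no constant works, stage k keeps the first p blocks of the current set and
    continues with blocks of some N' having a truncated norm above k + 2 p B. Changing p coordinates
    costs at most 2 p B, so the norm still exceeds k. Every block is eventually frozen, and the
    averages along the limit set are unbounded. *)
Lemma uniform_bound (x : nat -> X) (B : K) M : (forall i, `|x i| <= B) -> infinite_set M ->
  (forall N, infsub M N -> exists C, trunc_bounded s (block_average P N x) C) ->
  exists2 M', infsub M M' & exists C,
    forall N, infsub M' N -> trunc_bounded s (block_average P N x) C.
Proof.
move=> xB iM good; apply: contrapT => nunif.
have B0 : 0 <= B by apply: le_trans (xB 0%N).
have bad M' C : infsub M M' -> exists2 N, infsub M' N &
    exists m, C < s (trunc m (block_average P N x)).
  move=> MM'; apply: contrapT => H; apply: nunif; exists M' => //; exists C => N M'N m.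
  by rewrite leNgt; apply/negP => lt; apply: H; exists N => //; exists m.
have /choice[g gP] : forall kNp : nat * (set nat * nat), exists Np' : set nat * nat,
    let: (k, Np) := kNp in infsub M Np.1 -> [/\ infsub M Np'.1, (Np.2 < Np'.2)%N,
      forall j A, (j < Np.2)%N -> P Np'.1 j A = P Np.1 j A &
      k%:R < s (trunc Np'.2 (block_average P Np'.1 x))].
  move=> [k [N p]] /=; have [MN|nMN] := EM (infsub M N); last by exists (set0, 0%N).
  have [e Ne] := supp_nonempty blockP p MN.1.
  (* The point e lies in block p of N, so everything beyond e comes after the first p blocks. *)
  have [|N' N'M [m mlt]] := bad (M `&` [set i | (e < i)%N]) (k%:R + p%:R * (2 * B)).
    by split; [exact: infinite_above | move=> i []].
  have iN' := N'M.1; have MN' : N' `<=` M by move=> i /N'M.2[].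
  have eN' i : N' i -> (e < i)%N by move=> /N'M.2[].
  have [|iS Slt Sge] := splice_blocks blockP (p := p) MN.1 iN'.
    move=> j jp a b Na Nb; apply: ltn_trans (eN' b (supp_sub blockP iN' Nb)).
    exact: (supp_lt blockP MN.1 jp).
  exists (splice P N N' p, m) => _; split=> //.
  - split=> // i [j _]; case: ifP => _ Hi; first exact/MN.2/(supp_sub blockP MN.1 Hi).
    exact/MN'/(supp_sub blockP iN' Hi).
  (* Truncations to at most p coordinates have norm at most p B, too little for the hump. *)
  - rewrite ltnNge; apply/negP => mp; move: mlt; rewrite ltNge => /negP; apply.
    apply: le_trans (snorm_trunc_le bimon_s m (block_average_le iN' xB)) _.
    apply: (@le_trans _ _ (p%:R * B)); first by rewrite ler_wpM2r // ler_nat.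
    have : 0 <= p%:R * B by rewrite mulr_ge0.
    by have : 0 <= k%:R :> K by []; lra.
  - rewrite /= -(ltrD2r (p%:R * (2 * B))); apply: lt_le_trans mlt _.
    apply: snorm_trunc_close; first exact: block_average_close.
    by move=> j pj; apply/esym; apply: average_eq => A; exact: Sge.
pose st := fix st n := if n is k.+1 then g (k, st k) else (M, 0%N).
have stM n : infsub M (st n).1.
  by elim: n => [|n IH]; [exact: infsub_refl | have [] := gP (n, st n) IH].
have stP n : [/\ ((st n).2 < (st n.+1).2)%N,
    forall j A, (j < (st n).2)%N -> P (st n.+1).1 j A = P (st n).1 j A &
    n%:R < s (trunc (st n.+1).2 (block_average P (st n.+1).1 x))].
  by have [] := gP (n, st n) (stM n).
have st_mono : {mono (fun n => (st n).2) : i j / (i < j)%N}.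
  apply: homo_ltn_mono; apply: (homo_ltn ltn_trans) => n.
  by have [] := stP n.
have st_ge n : (n <= (st n).2)%N.
  by apply: (@homo_ltn_ge (fun n => (st n).2)) => i j; rewrite st_mono.
have agree m n j A : (m <= n)%N -> (j < (st m).2)%N -> P (st n).1 j A = P (st m).1 j A.
  move=> mn jm; elim: n mn => [|n IH]; first by rewrite leqn0 => /eqP ->.
  rewrite leq_eqVlt => /predU1P[->//|mn].
  have [_ E _] := stP n; rewrite E ?IH //; apply: leq_trans jm _.
  rewrite leqNgt; apply/negP => lt; move: (st_mono n m).
  by rewrite lt => /esym; rewrite ltnNge => /negP; apply.
(* At least j + 1 blocks are frozen at stage j + 1, so its block number j is final; U j has it as
   first block. *)
pose U j := tail_union (fun i => supp (P (st j.+1).1 i)) j.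
have iU j : infinite_set (U j) by have [] := tail_block blockP j (stM j.+1).1.
have PU j A : P (U j) 0%N A = P (st j.+1).1 j A.
  by have [_ _] := tail_block blockP j (stM j.+1).1; exact.
have [j|iW PW] := concat_blocks blockP iU.
  rewrite (supp_eq (PU j)) (supp_eq (PU j.+1)).
  rewrite -(supp_eq (fun A => @agree j.+1 j.+2 j A (leqnSn _) (st_ge j.+1))).
  exact: (@block_successive _ _ _ blockP _ j (stM j.+2).1).
set W := \bigcup_j _ in iW PW.
have MW : infsub M W.
  split=> // i [j _]; rewrite (supp_eq (PU j)) => Hi.
  exact/(stM j.+1).2/(supp_sub blockP (stM j.+1).1 Hi).
have [C WC] := good W MW.
have [k Ck] : exists k : nat, C <= k%:R.
  by exists (Num.truncn `|C|).+1; apply: le_trans (ler_norm _) _; apply/ltW/truncnS_gt.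
have [_ _] := stP k; rewrite ltNge => /negP; apply.
apply: le_trans Ck; rewrite (@eq_trunc _ _ _ _ (block_average P W x)) //.
move=> j jk; apply: average_eq => A; rewrite PW PU.
have [jk'|kj] := leqP j.+1 k.+1; first exact: agree.
by apply/esym; apply: agree => //; exact: ltnW.
Qed.

Implicit Types x y : nat -> X.

Definition bounded_on (x : nat -> X) (M : set nat) (C : K) :=
  forall N, infsub M N -> trunc_bounded s (block_average P N x) C.

Lemma bounded_onS x M N C : bounded_on x M C -> infsub M N -> bounded_on x N C.
Proof. by move=> xM MN N' NN'; apply: xM; exact: infsub_trans NN'. Qed.

Lemma bounded_onW x M C D : bounded_on x M C -> C <= D -> bounded_on x M D.
Proof. by move=> xM CD N MN m; apply: le_trans (xM N MN m) CD. Qed.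

Lemma block_averageD x y N : infinite_set N ->
  block_average P N (x + y) = block_average P N x + block_average P N y.
Proof.
by move=> iN; apply/funext => j; apply: averageD; exact: (supp_finite blockP).
Qed.

Lemma block_averageZ (a : K) x N : infinite_set N ->
  block_average P N (a *: x) = a *: block_average P N x.
Proof.
by move=> iN; apply/funext => j; apply: averageZ; exact: (supp_finite blockP).
Qed.

Lemma bounded_onD x y M C D : bounded_on x M C -> bounded_on y M D ->
  bounded_on (x + y) M (C + D).
Proof.
move=> xM yM N MN m; rewrite (block_averageD _ _ MN.1) truncD.
apply: le_trans (snormD bimon_s _ _) _; try exact: fin_supp_trunc.
by apply: lerD; [exact: xM | exact: yM].
Qed.

Lemma bounded_onZ (a : K) x M C : bounded_on x M C -> bounded_on (a *: x) M (`|a| * C).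
Proof.
move=> xM N MN m; rewrite (block_averageZ _ _ MN.1) truncZ.
rewrite (snormZ bimon_s); last exact: fin_supp_trunc.
by apply: ler_wpM2l => //; exact: xM.
Qed.

(* The diagonal set is so sparse that its blocks from number i on can be      *)
(* preceded by the first i blocks of M i.                                     *)
Lemma diagonal_bound (v : nat -> nat -> X) (M : nat -> set nat) (B D : K) :
  (forall i k, `|v i k| <= B) -> (forall i, infsub (M i) (M i.+1)) ->
  (forall i, bounded_on (v i) (M i) D) ->
  exists2 L, infsub (M 0%N) L & forall i, bounded_on (v i) L (D + i%:R * (2 * B)).
Proof.
move=> vB Mdec vM; have iM i : infinite_set (M i).
  by case: i => [|i]; [apply: sub_infinite_set (Mdec 0%N).1; exact: (Mdec 0%N).2
                     | exact: (Mdec i).1].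
have Msub i j : (i <= j)%N -> M j `<=` M i.
  elim: j => [|j IH]; first by rewrite leqn0 => /eqP ->.
  rewrite leq_eqVlt => /predU1P[->//|ij].
  exact: subset_trans (Mdec j).2 (IH ij).
(* The bound e i <= f i puts f([i, oo)) after the first i blocks of M i. *)
have /choice[e eP] : forall i, exists e, supp (P (M i) i) e.
  by move=> i; exact: (supp_nonempty blockP).
have [f [fi fM]] := @diagonal_sequence M e iM.
have iL : infinite_set (range f) by apply: infinite_homo_image => //; exact: infinite_nat.
exists (range f); first by split=> // _ [i _ <-]; apply: Msub (leq0n i) _ (fM i).1.
move=> i N [iN Nf] m.
have Nblock j a : (i <= j)%N -> supp (P N j) a -> exists2 c, (i <= c)%N & f c = a.
  move=> ij Na; have [c _ ca] := Nf a (supp_sub blockP iN Na).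
  exists c => //; apply: leq_trans ij _.
  by apply: (block_index_le blockP fi iN Nf (i := j)); rewrite /= ca.
have [|iS Slt Sge] := splice_blocks blockP (p := i) (iM i) iN.
  move=> j ji a b Ma Nb; have [c ic <-] := Nblock i b (leqnn i) Nb.
  apply: leq_trans (supp_lt blockP (iM i) ji Ma (eP i)) _.
  apply: leq_trans (fM i).2 _.
  by rewrite (leq_mono fi).
have Si : infsub (M i) (splice P (M i) N i).
  split=> // a [j _]; case: ltnP => ij Ha; first exact: (supp_sub blockP) Ha.
  by have [c ic <-] := Nblock j a ij Ha; apply: Msub ic _ (fM c).1.
apply: le_trans (lerD (vM i _ Si m) (lexx _)).
apply: snorm_trunc_close; first exact: block_average_close (vB i).
by move=> j ij; apply/esym; apply: average_eq => A; exact: Sge.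
Qed.

(** * Uniform bounds on the unit ball *)

Variables (R : set (nat -> X)) (r : (nat -> X) -> K).
Hypothesis subseqR : subsequential_space R r.

Lemma space_norm_ge0 x : R x -> 0 <= r x.
Proof. by have [H _ _ _] := subseq_norm subseqR; exact: H. Qed.

Lemma space_normD x y : R x -> R y -> r (x + y) <= r x + r y.
Proof. by have [_ _ _ H] := subseq_norm subseqR; exact: H. Qed.

Lemma space_normZ (a : K) x : R x -> r (a *: x) = `|a| * r x.
Proof. by have [_ _ H _] := subseq_norm subseqR; exact: H. Qed.

Lemma spaceD x y : R x -> R y -> R (x + y).
Proof. by have [_ H _] := subseq_subspace subseqR; exact: H. Qed.

Lemma spaceZ (a : K) x : R x -> R (a *: x).
Proof. by have [_ _ H] := subseq_subspace subseqR; exact: H. Qed.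

Lemma spaceB x y : R x -> R y -> R (x - y).
Proof. by move=> Rx Ry; rewrite -scaleN1r; apply: spaceD => //; exact: spaceZ. Qed.

Lemma space_normB x y : R x -> R y -> r (x - y) = r (y - x).
Proof.
move=> Rx Ry; rewrite -opprB -scaleN1r space_normZ; last exact: spaceB.
by rewrite normrN normr1 mul1r.
Qed.

Lemma space_norm0 x : R x -> r x = 0 -> x = 0.
Proof. by have [_ H _ _] := subseq_norm subseqR; exact: H. Qed.

Lemma unit_ball_scale x : R x -> r x != 0 -> unit_ball R r ((r x)^-1 *: x).
Proof.
move=> Rx rx0; split; first exact: spaceZ.
rewrite space_normZ // ger0_norm ?invr_ge0 ?space_norm_ge0 //.
by rewrite mulVf.
Qed.

Lemma space_norm_ge x i : R x -> `|x i| <= r x.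
Proof.
have ball y : unit_ball R r y -> `|y i| <= 1.
  move=> By; apply: le_trans (subseq_ball subseqR By).
  (* [sup] dominates the terms only for a set bounded above, which membership in R guarantees. *)
  have [A [Ar HA]] := subseq_linf subseqR By.1.
  apply: ub_le_sup; last by exists i.
  exists (A + 1) => _ [k _ <-]; apply: HA => //.
  by rewrite ltrDl.
move=> Rx; have [rx0|rx0] := eqVneq (r x) 0.
  by rewrite (space_norm0 Rx rx0) normr0 space_norm_ge0 // -(space_norm0 Rx rx0).
have := ball _ (unit_ball_scale Rx rx0); rewrite fctE normrZ.
have rxp : 0 < r x by rewrite lt_neqAle eq_sym rx0 space_norm_ge0.
by rewrite normfV (gtr0_norm rxp) mulrC ler_pdivrMr // mul1r.
Qed.

Lemma space_subseq x (phi : nat -> nat) : R x -> {homo phi : i j / (i < j)%N} ->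
  R (x \o phi).
Proof.
move=> Rx phii; have [rx0|rx0] := eqVneq (r x) 0.
  suff -> : x \o phi = x by [].
  by rewrite (space_norm0 Rx rx0).
have [H _] := subseq_subseq subseqR (unit_ball_scale Rx rx0) phii.
have -> : x \o phi = r x *: (((r x)^-1 *: x) \o phi).
  by apply/funext => i; rewrite !fctE /= scalerA divff // scale1r.
exact: spaceZ.
Qed.

Lemma bounded_fun_average x N : R x -> infinite_set N ->
  bounded_fun (block_average P N x).
Proof.
move=> Rx iN; exists (r x); split; first by rewrite num_real.
move=> A rA i _; apply: le_trans (ltW rA).
by apply: block_average_le => // j; exact: space_norm_ge.
Qed.

Lemma unit_ball_le x i : unit_ball R r x -> `|x i| <= 1.
Proof. by move=> [Rx x1]; exact: le_trans (space_norm_ge i Rx) x1. Qed.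

Lemma bounded_everywhere_of_somewhere :
  (forall x, R x -> exists2 M, infinite_set M & exists C, bounded_on x M C) ->
  forall x L, R x -> infinite_set L ->
  exists2 M, infsub L M & exists C, bounded_on x M C.
Proof.
move=> H x L Rx iL; have [phi [phii phiL phiP]] := transfer iL.
have [M iM [C xM]] := H _ (space_subseq Rx phii).
have [||||M' LM' xM'] := phiP x (r x + 1) C M.
- by rewrite ltr_wpDl // space_norm_ge0.
- by move=> i; apply: le_trans (space_norm_ge i Rx) _; rewrite lerDl.
- exact: iM.
- exact: xM.
by exists M' => //; exists (C + (r x + 1)).
Qed.

(** The constant added by [transfer] is the bound 1 on the terms of x, so uniformity over the ball
    is preserved. *)
Lemma bounded_ball_everywhere_of_somewhere D :
  (forall x, unit_ball R r x -> exists2 M, infinite_set M & bounded_on x M D) ->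
  forall x L, unit_ball R r x -> infinite_set L ->
  exists2 M, infsub L M & bounded_on x M (D + 1).
Proof.
move=> H x L Bx iL; have [phi [phii phiL phiP]] := transfer iL.
have [M iM xM] := H _ (subseq_subseq subseqR Bx phii).
by apply: (phiP x 1 D M) => // i; exact: unit_ball_le.
Qed.

Lemma bounded_of_ball D L :
  (forall x, unit_ball R r x -> exists2 M, infsub L M & bounded_on x M D) ->
  forall x, R x -> exists2 M, infsub L M & exists C, bounded_on x M C.
Proof.
move=> H x Rx; pose a := r x + 1.
have a0 : 0 < a by rewrite ltr_wpDl // space_norm_ge0.
have [|M LM xM] := H (a^-1 *: x).
  split; first exact: spaceZ.
  by rewrite space_normZ // gtr0_norm ?invr_gt0 // ler_pdivrMl // mulr1 lerDl.
exists M => //; exists (`|a| * D).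
have -> : x = a *: (a^-1 *: x) by rewrite scalerA divff ?gt_eqF // scale1r.
exact: bounded_onZ.
Qed.

Lemma bounded_on_domain_ball x M C N : R x -> bounded_on x M C -> infsub M N ->
  domain_ball s C (block_average P N x).
Proof.
move=> Rx xM MN; apply: (domain_ballP bimon_s) (xM N MN).
exact: bounded_fun_average Rx MN.1.
Qed.

Lemma natural_domain_uniform x M : R x -> infinite_set M ->
  (forall N, infsub M N -> natural_domain s (block_average P N x)) ->
  exists2 M', infsub M M' & exists C, bounded_on x M' C.
Proof.
move=> Rx iM H; apply: (@uniform_bound x (r x) M) => // [i|N MN].
  exact: space_norm_ge.
by apply: (natural_domainP bimon_s); exact: H.
Qed.

Lemma domain_ball_bounded_on x M C :
  (forall N, infsub M N -> domain_ball s C (block_average P N x)) ->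
  bounded_on x M C.
Proof. by move=> H N MN; apply/(ext_norm_le bimon_s); have [] := H N MN. Qed.

Section UniformBound.

Hypothesis bounded_everywhere : forall x L, R x -> infinite_set L ->
  exists2 M, infsub L M & exists C, bounded_on x M C.

(* If not, balls avoiding the sequences bounded by k on subsets of some L k   *)
(* could be nested, and their common point would be unbounded on every subset *)
(* of a diagonal set.                                                         *)
Lemma bounded_dense_in_ball : exists L C u0 (d : K),
  [/\ infinite_set L, R u0, 0 < d & forall M u, infsub L M -> R u -> r (u - u0) <= d ->
    forall eta : K, 0 < eta -> exists v, [/\ R v, r (v - u) <= eta &
      exists2 M', infsub M M' & bounded_on v M' C]].
Proof.
apply: contrapT => none.
pose escape (C : K) (L : set nat) u0 d (L' : set nat) u d' :=
  [/\ infsub L L' /\ R u, r (u - u0) <= d / 2, 0 < d' <= d / 2 &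
    forall v M, R v -> r (v - u) <= d' -> infsub L' M -> ~ bounded_on v M C].
have step C L u0 (d : K) : infinite_set L -> R u0 -> 0 < d ->
    exists L' u d', escape C L u0 d L' u d'.
  move=> iL Ru0 d0; apply: contrapT => H; apply: none.
  exists L, C, u0, (d / 2); split=> //; first by rewrite divr_gt0.
  move=> M u LM Ru ud eta eta0; apply: contrapT => nv; apply: H.
  exists M, u, (Num.min eta (d / 2)); split=> //.
    by rewrite lt_min eta0 divr_gt0 //= ge_min lexx orbT.
  move=> v M' Rv; rewrite le_min => /andP[ve _] MM' bM'; apply: nv.
  by exists v; split=> //; exists M'.
pose state := (set nat * (nat -> X) * K)%type.
pose ok (t : state) := [/\ infinite_set t.1.1, R t.1.2 & 0 < t.2].
have /choice[g gP] : forall kt : nat * state, exists t' : state, ok kt.2 ->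
    escape kt.1%:R kt.2.1.1 kt.2.1.2 kt.2.2 t'.1.1 t'.1.2 t'.2.
  move=> [k [[L u] d]]; have [[iL Ru d0]|nok] := EM (ok (L, u, d)).
    by have [L' [u' [d' H]]] := step k%:R L u d iL Ru d0; exists (L', u', d').
  by exists (L, u, d).
have [R0 _ _] := subseq_subspace subseqR.
pose st := fix st n : state := if n is k.+1 then g (k, st k) else (setT, 0, 1).
have ok_st n : ok (st n).
  elim: n => [|n IH]; first by split=> //=; exact: infinite_nat.
  by have [[[iL _] Ru] _ /andP[d0 _] _] := gP (n, st n) IH.
have stP n := gP (n, st n) (ok_st n).
pose u n := (st n).1.2; pose d n := (st n).2; pose L n := (st n).1.1.
have Ru n : R (u n) by have [] := ok_st n.
have d0 n : 0 < d n by have [] := ok_st n.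
have dS n : d n.+1 <= d n / 2 by have [_ _ /andP[]] := stP n.
have dpow n : d n <= (2 ^+ n)^-1.
  elim: n => [|n IH]; first by rewrite expr0 invr1.
  apply: le_trans (dS n) _; rewrite exprS invfM mulrC ler_pM2l ?invr_gt0 //.
(* One step moves by at most d n / 2, which is at most d n - d n.+1; the sum telescopes. *)
have udist k n : (k <= n)%N -> r (u n - u k) <= d k - d n.
  elim: n => [|n IH].
    by rewrite leqn0 => /eqP ->; rewrite !subrr -(scale0r 0) space_normZ // normr0 mul0r.
  rewrite leq_eqVlt => /predU1P[->|kn].
    by rewrite !subrr -(scale0r 0) space_normZ // normr0 mul0r.
  have -> : u n.+1 - u k = (u n.+1 - u n) + (u n - u k) by rewrite addrA subrK.
  apply: le_trans (space_normD _ _) _; try exact: spaceB.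
  have := IH kn; have [_ + _ _] := stP n; have := dS n.
  rewrite -/(u n) -/(d n) -[_.1.2]/(u n.+1); lra.
have [v Rv uv] : exists2 v, R v & (fun n => r (u n - v)) @ \oo --> (0 : K).
  apply: (subseq_complete subseqR) => // eps eps0.
  pose n0 := (Num.truncn (2 / eps)).+1; exists n0 => n m nn0 mn0.
  have small : 2 * d n0 < eps.
    have : 2 / eps < 2 ^+ n0.
      apply: lt_trans (truncnS_gt _) _; rewrite -natrX ltr_nat.
      exact: ltn_expl.
    rewrite ltr_pdivrMr // mulrC -ltr_pdivrMr ?exprn_gt0 // => h.
    by apply: le_lt_trans h; rewrite ler_pM2l // dpow.
  have -> : u n - u m = (u n - u n0) + (u n0 - u m) by rewrite addrA subrK.
  apply: le_lt_trans (space_normD _ _) _; try exact: spaceB.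
  rewrite [r (u n0 - u m)]space_normB //.
  have := udist n0 n nn0; have := udist n0 m mn0; have := d0 n; have := d0 m; lra.
have vdist k : r (v - u k) <= d k.
  apply/ler_addgt0Pr => eta eta0.
  have /cvgrPdist_lt/(_ eta eta0)[n0 _ Hn0] := uv.
  have := Hn0 (maxn n0 k) (leq_maxl _ _); rewrite /= sub0r normrN.
  rewrite ger0_norm; last by apply: space_norm_ge0; exact: spaceB.
  rewrite space_normB // => h; have := udist k (maxn n0 k) (leq_maxr _ _).
  have -> : v - u k = (v - u (maxn n0 k)) + (u (maxn n0 k) - u k) by rewrite addrA subrK.
  move=> h'; apply: le_trans (space_normD _ _) _; try exact: spaceB.
  by have := d0 (maxn n0 k); move: h h'; lra.
have iL n : infinite_set (L n) by have [] := ok_st n.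
have Ldec n : infsub (L n) (L n.+1) by have [[]] := stP n.
have [f [fi fL]] := @diagonal_sequence (fun n => L n.+1) (fun=> 0%N) (fun n => iL n.+1).
have iLf : infinite_set (range f) by apply: infinite_homo_image => //; exact: infinite_nat.
have [M [iM Mf] [C vM]] := bounded_everywhere Rv iLf.
have [k Ck] : exists k : nat, C <= k%:R.
  by exists (Num.truncn `|C|).+1; apply: le_trans (ler_norm _) _; apply/ltW/truncnS_gt.
(* Beyond f k the set lies in L k.+1, on no infinite subset of which a sequence within d k.+1 of u
   k.+1 is bounded by k. *)
pose M' := M `&` [set i | (f k < i)%N].
have iM' : infinite_set M' by exact: infinite_above.
have [_ _ _ esc] := stP k.
apply: (esc v M' Rv (vdist k.+1)); last first.
  by apply: bounded_onW Ck; apply: (bounded_onS vM); split=> // i [].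
split=> // i [/Mf[c _ <-] /=]; rewrite (homo_ltn_mono fi) => kc.
have Lsub a b : (a <= b)%N -> L b `<=` L a.
  elim: b => [|b IH]; first by rewrite leqn0 => /eqP ->.
  rewrite leq_eqVlt => /predU1P[->//|ab].
  exact: subset_trans (Ldec b).2 (IH ab).
by apply: (Lsub k.+1 c.+1) (fL c).1; exact: ltnW.
Qed.

(** w is 1/d times the difference of u0 + d w and u0, both in the ball of [bounded_dense_in_ball].
    Approximating each within d/4, the second one inside the set found for the first, gives error
    1/2 and the bound (C + C)/d. *)
Lemma bounded_approximation : exists L D, infinite_set L /\
  forall M w, infsub L M -> R w -> r w <= 1 ->
  exists v, [/\ R v, r (w - v) <= 2^-1 &
    exists2 M', infsub M M' & bounded_on v M' D].
Proof.
have [L [C [u0 [d [iL Ru0 d0 H]]]]] := bounded_dense_in_ball.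
exists L, (d^-1 * (C + C)); split=> // M w LM Rw w1.
have d4 : 0 < d / 4 by rewrite divr_gt0.
have Rdw : R (u0 + d *: w) by apply: spaceD => //; exact: spaceZ.
have [|v1 [Rv1 v1d [M1 MM1 v1M1]]] := H M _ LM Rdw _ _ d4.
  by rewrite addrAC subrr add0r space_normZ // gtr0_norm // ler_piMr // ltW.
have [|v2 [Rv2 v2d [M2 MM2 v2M2]]] := H M1 _ (infsub_trans LM MM1) Ru0 _ _ d4.
  have [R0 _ _] := subseq_subspace subseqR.
  by rewrite subrr -(scale0r 0) space_normZ // normr0 mul0r ltW.
have Rv12 := spaceB Rv1 Rv2.
exists (d^-1 *: (v1 - v2)); split; first exact: spaceZ.
  have -> : w - d^-1 *: (v1 - v2) = d^-1 *: ((u0 + d *: w - v1) + (v2 - u0)).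
    have -> : u0 + d *: w - v1 + (v2 - u0) = d *: w - (v1 - v2).
      rewrite [v2 - u0]addrC addrA [u0 + _]addrC [_ - v1 - u0]addrAC addrK opprB.
      by rewrite -addrA [- v1 + v2]addrC.
    by rewrite [RHS]scalerBr scalerA mulVf ?gt_eqF // scale1r.
  rewrite space_normZ; last by apply: spaceD; exact: spaceB.
  rewrite gtr0_norm ?invr_gt0 // ler_pdivrMl //.
  apply: le_trans (space_normD _ _) _; try exact: spaceB.
  by rewrite space_normB //; move: v1d v2d; lra.
exists M2; first exact: infsub_trans MM1 MM2.
rewrite -[X in X * _]gtr0_norm ?invr_gt0 //; apply: bounded_onZ.
apply: bounded_onD; first exact: bounded_onS v1M1 MM2.
rewrite -[C]mul1r -(normr1 K) -normrN -scaleN1r; exact: bounded_onZ.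
Qed.

(** Doubling the remainder, w_(n+1) = 2 (w_n - v_n), keeps it in the ball. On the diagonal set v_i
    is bounded by D + 4 i, and the weights 2^-i make these bounds summable. For truncation at m the
    expansion is stopped after m terms, since the truncated norm for w_m is at most m. *)
Lemma uniform_bound_on_ball : exists D, forall w, unit_ball R r w ->
  exists2 M, infinite_set M & bounded_on w M D.
Proof.
have [L [D [iL H]]] := bounded_approximation.
(* 4 (D + 4) bounds the sum of (D + 4 i) / 2^i, and 1 bounds the remainder m / 2^m. *)
exists (4 * (D + 4) + 1) => w0 [Rw0 w01].
have /choice[g gP] : forall wM : (nat -> X) * set nat,
    exists vM : (nat -> X) * set nat, R wM.1 -> r wM.1 <= 1 -> infsub L wM.2 ->
    [/\ R vM.1, r (wM.1 - vM.1) <= 2^-1, infsub wM.2 vM.2 & bounded_on vM.1 vM.2 D].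
  move=> [w M]; have [[Rw w1 LM]|n] := EM [/\ R w, r w <= 1 & infsub L M].
    by have [v [Rv wv [M' MM' vM']]] := H M w LM Rw w1; exists (v, M').
  by exists (w, M) => /= Rw w1 LM; case: n.
pose st := fix st n := if n is k.+1 then
  (2 *: ((st k).1 - (g (st k)).1), (g (st k)).2) else (w0, L).
have st_ok n : [/\ R (st n).1, r (st n).1 <= 1 & infsub L (st n).2].
  elim: n => [|n [Rw w1 LM]]; first by split=> //; exact: infsub_refl.
  have [Rv wv MM' _] := gP (st n) Rw w1 LM; split=> /=.
  - by apply: spaceZ; exact: spaceB.
  - rewrite space_normZ ?gtr0_norm //; last exact: spaceB.
    by move: wv; lra.
  - exact: infsub_trans MM'.
pose w n := (st n).1; pose v n := (g (st n)).1.
have Rw n : R (w n) by have [] := st_ok n.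
have w1 n : r (w n) <= 1 by have [] := st_ok n.
have vP n := let: And3 a b c := st_ok n in gP (st n) a b c.
have wE n : w n = v n + 2^-1 *: w n.+1.
  by rewrite /w /= scalerA mulVf // scale1r addrC subrK.
have Rv n : R (v n) by have [] := vP n.
have vB n k : `|v n k| <= 2.
  apply: le_trans (space_norm_ge k (Rv n)) _.
  rewrite -[v n](subKr (w n)); have [_ wv _ _] := vP n.
  apply: le_trans (space_normD _ _) _ => //.
    by rewrite -scaleN1r; apply: spaceZ; exact: spaceB.
  rewrite -scaleN1r space_normZ; last exact: spaceB.
  by rewrite normrN normr1 mul1r; have := w1 n; move: wv; rewrite -/(w n) -/(v n); lra.
have [||M [iM _] MP] := @diagonal_bound v (fun n => (g (st n)).2) 2 D vB.
- by move=> n; have [_ _ ] := vP n.+1.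
- by move=> n; have [] := vP n.
exists M => // N MN m.
have D0 : 0 <= D.
  have [_ _ [iN _] /(_ _ (infsub_refl _)) /(_ 0%N)] := vP 0%N.
  by rewrite trunc0 (snorm0 bimon_s); apply.
pose a n := s (trunc m (block_average P N (w n))).
have a_step n : a n <= (D + n%:R * 4) + 2^-1 * a n.+1.
  rewrite /a [in leLHS]wE block_averageD ?block_averageZ ?MN.1 //; try exact: MN.1.
  rewrite truncD truncZ; apply: le_trans (snormD bimon_s _ _) _.
  - exact: fin_supp_trunc.
  - by apply: fin_suppZ; exact: fin_supp_trunc.
  rewrite (snormZ bimon_s); last exact: fin_supp_trunc.
  rewrite gtr0_norm ?invr_gt0 // lerD2r; apply: le_trans (MP n N MN m) _.
  by rewrite lerD2l ler_wpM2l //; lra.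
(* Uses D + 4 i <= (D + 4)(i + 1); the sum of (i + 1) / 2^i over i < n is 4 - (n + 2) 2 / 2^n. *)
have a_bound n : a 0%N <= (D + 4) * (4 - (n%:R + 2) * 2 / 2 ^+ n) + a n / 2 ^+ n.
  elim: n => [|n IH]; first by rewrite expr0 !divr1; lra.
  apply: le_trans IH _.
  have p2 : 0 < (2 ^+ n)^-1 :> K by rewrite invr_gt0 exprn_gt0.
  have h := a_step n.
  have h1 : a n / 2 ^+ n <= ((D + n%:R * 4) + 2^-1 * a n.+1) / 2 ^+ n by rewrite ler_pM2r.
  have h2 : (D + n%:R * 4) / 2 ^+ n <= (D + 4) * (n%:R + 1) / 2 ^+ n.
    rewrite ler_pM2r //; have : 0 <= D * n%:R by rewrite mulr_ge0.
    lra.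
  have h3 : (D + 4) * (4 - (n.+1%:R + 2) * 2 / 2 ^+ n.+1) =
     (D + 4) * (4 - (n%:R + 2) * 2 / 2 ^+ n) + (D + 4) * (n%:R + 1) / 2 ^+ n.
    by rewrite -natr1 exprS; field; rewrite expf_neq0.
  have h4 : ((D + n%:R * 4) + 2^-1 * a n.+1) / 2 ^+ n =
     (D + n%:R * 4) / 2 ^+ n + a n.+1 / 2 ^+ n.+1.
    by rewrite exprS; field; rewrite expf_neq0.
  by rewrite h3; move: h1 h2; rewrite h4; lra.
have am : a m / 2 ^+ m <= 1.
  rewrite ler_pdivrMr ?exprn_gt0 // mul1r.
  apply: le_trans (snorm_trunc_le bimon_s m (B := 1) _) _.
    apply: block_average_le MN.1 _ => i.
    exact: le_trans (space_norm_ge i (Rw m)) (w1 m).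
  by rewrite mulr1 -natrX ler_nat ltnW // ltn_expl.
have := a_bound m; have : 0 <= (D + 4) * ((m%:R + 2) * 2 / 2 ^+ m).
  by rewrite mulr_ge0 ?addr_ge0 // divr_ge0 ?exprn_ge0 // mulr_ge0 ?addr_ge0.
rewrite mulrBr; move: am; rewrite -[a 0%N]/(s _); lra.
Qed.

End UniformBound.

End Transfer.

(** * The cycle of implications *)

Theorem theorem1p4 (K : realType) (xi : ord)
    (P : set nat -> nat -> probability nat K) (F : set (set nat))
    (blockP : probability_block P F) (homP : homogeneous xi P F)
    (X : completeNormedModType K)
    (R : set (nat -> X)) (r : (nat -> X) -> K)
    (subseqR : subsequential_space R r)
    (s : (nat -> X) -> K) (bimon_s : bimonotone_norm s) :
  [<->
    (* 1 *)
    (forall x, R x ->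
      exists2 M, infsub setT M &
        forall N, infsub M N -> natural_domain s (block_average P N x));
    (* 2 *)
    (forall x, R x ->
      exists2 M, infsub setT M & exists C : K,
        forall N, infsub M N -> domain_ball s C (block_average P N x));
    (* 3 *)
    (exists C : K, forall x, unit_ball R r x ->
      exists2 M, infsub setT M &
        forall N, infsub M N -> domain_ball s C (block_average P N x));
    (* 4 *)
    (forall x L, R x -> infsub setT L ->
      exists2 M, infsub L M &
        forall N, infsub M N -> natural_domain s (block_average P N x));
    (* 5 *)
    (forall x L, R x -> infsub setT L ->
      exists2 M, infsub L M & exists C : K,
        forall N, infsub M N -> domain_ball s C (block_average P N x));
    (* 6 *)
    (exists C : K, forall x L, unit_ball R r x -> infsub setT L ->
      exists2 M, infsub L M &
        forall N, infsub M N -> domain_ball s C (block_average P N x)) ].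
Proof.
have space_infsub M : infsub setT M -> infinite_set M by case.
have infsub_space M : infinite_set M -> infsub setT M by split.
(* The transfer is used twice: here for each x, to feed the Baire argument, and in [everywhere] for
   the ball, to carry the uniform constant into every L. *)
have somewhere :
    (forall x, R x -> exists2 M, infsub setT M & exists C : K,
      forall N, infsub M N -> domain_ball s C (block_average P N x)) ->
    exists C : K, forall x, unit_ball R r x ->
      exists2 M, infinite_set M & bounded_on P s x M C.
  move=> H; apply: (uniform_bound_on_ball blockP bimon_s subseqR).
  apply: (bounded_everywhere_of_somewhere blockP bimon_s homP subseqR) => x Rx.
  have [M [iM _] [C HC]] := H x Rx; exists M => //; exists C.
  exact: domain_ball_bounded_on HC.
have everywhere : (exists C : K, forall x, unit_ball R r x ->
      exists2 M, infinite_set M & bounded_on P s x M C) ->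
    exists C : K, forall x L, unit_ball R r x -> infsub setT L ->
      exists2 M, infsub L M & bounded_on P s x M C.
  move=> [C H]; exists (C + 1) => x L Bx [iL _].
  exact: (bounded_ball_everywhere_of_somewhere blockP bimon_s homP subseqR H).
tfae.
- move=> H x Rx; have [M [iM _] HM] := H x Rx.
  have [M' MM' [C HC]] := natural_domain_uniform blockP bimon_s subseqR Rx iM HM.
  exists M'; first exact: infsub_space MM'.1.
  by exists C => N; exact: (bounded_on_domain_ball blockP bimon_s subseqR Rx HC).
- move=> /somewhere[C H]; exists C => x Bx; have [M iM HM] := H x Bx.
  exists M; first exact: infsub_space.
  by move=> N; exact: (bounded_on_domain_ball blockP bimon_s subseqR Bx.1 HM).
- move=> [C H] x L Rx iL; have [|D HD] := everywhere.
    exists C => x' Bx'; have [M [iM _] HM] := H x' Bx'; exists M => //.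
    exact: domain_ball_bounded_on HM.
  have [M LM [C' HC']] := bounded_of_ball blockP bimon_s subseqR
    (fun x' Bx' => HD x' L Bx' iL) Rx.
  exists M => // N MN.
  by have [] := bounded_on_domain_ball blockP bimon_s subseqR Rx HC' MN.
- move=> H x L Rx iL; have [M LM HM] := H x L Rx iL.
  have [M' MM' [C HC]] := natural_domain_uniform blockP bimon_s subseqR Rx LM.1 HM.
  exists M'; first exact: infsub_trans MM'.
  by exists C => N; exact: (bounded_on_domain_ball blockP bimon_s subseqR Rx HC).
- move=> H; have [|C HC] := everywhere.
    by apply: somewhere => x Rx; apply: H => //; exact/infsub_space/infinite_nat.
  exists C => x L Bx iL; have [M LM HM] := HC x L Bx iL; exists M => // N.
  exact: (bounded_on_domain_ball blockP bimon_s subseqR Bx.1 HM).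
- move=> [C H] x Rx.
  have [|M LM [C' HC']] := bounded_of_ball (L := setT) (D := C) blockP bimon_s subseqR _ Rx.
    move=> x' Bx'; have [|M LM HM] := H x' setT Bx'; first exact/infsub_space/infinite_nat.
    by exists M => //; exact: domain_ball_bounded_on HM.
  exists M => // N MN.
  by have [] := bounded_on_domain_ball blockP bimon_s subseqR Rx HC' MN.
Qed.
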